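(* For $n\in\mathbb{N}$, $n\ge 1$, let $\mathbb{M}_n$ be the $n$-th stage of the standard slit carpet, and let $C_n$ be its optimal Euclidean distortion, i.e. the infimum of all $C\ge 1$ for which there exist $N\in\mathbb{N}$ and a $(1,C)$-bi-Lipschitz embedding $f:\mathbb{M}_n\to\mathbb{R}^N$. Then $$C_n\in\Omega\left(\sqrt{\frac{n}{\log n}}\right)\qquad\text{and}\qquad C_n\in O(\sqrt n),$$ that is, there exist constants $c,C>0$ and $n_0\ge 2$ such that $c\sqrt{n/\log n}\le C_n\le C\sqrt n$ for all $n\ge n_0$.
   Context: A map $f:(X,d_X)\to(Y,d_Y)$ is $(a,b)$-bi-Lipschitz if $a\,d_X(x,y)\le d_Y(f(x),f(y))\le b\,d_X(x,y)$ for all $x,y\in X$. $\mathbb{R}^N$ carries the Euclidean metric. Construction of $\mathbb{M}_n$. Let $M_0=\mathbb{M}_0=[0,1]^2$. For $n\ge1$ and $l,k\in\{0,\dots,2^n-1\}$ let $s^n_{l,k}$ be the closed vertical segment (slit) with endpoints $((2l+1)2^{-n-1},(4k+1)2^{-n-2})$ and $((2l+1)2^{-n-1},(4k+3)2^{-n-2})$; it lies in the center of the dyadic square $[l2^{-n},(l+1)2^{-n}]\times[k2^{-n},(k+1)2^{-n}]$ and has half its side length. Recursively, $M_n:=M_{n-1}\setminus\bigcup_{l,k}s^n_{l,k}$. Equip $M_n$ with its path metric (infimum of Euclidean lengths of paths in $M_n$ joining two points); $(\mathbb{M}_n,d_{\mathbb{M}_n})$ is the metric completion. *)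

(* Defs.v *)
From HB Require Import structures.
From mathcomp Require Import all_boot all_order all_algebra.
From mathcomp Require Import generic_quotient.
From mathcomp Require Import all_classical all_reals all_analysis.
From mathcomp Require Import zify ring lra.

Set Implicit Arguments.
Unset Strict Implicit.
Unset Printing Implicit Defensive.

Import Order.TTheory GRing.Theory Num.Theory.
Import numFieldNormedType.Exports.

Local Open Scope classical_set_scope.
Local Open Scope ring_scope.

(* ['rV[R]_N] carries the sup norm in the library; [euclidean R N] is a copy of
   it carrying the Euclidean metric instead. *)
Definition euclidean (R : realType) (N : nat) : Type := 'rV[R]_N.

Definition euclidean_dist (R : realType) (N : nat) (p q : euclidean R N) : R :=
  Num.sqrt (\sum_(i < N) (p 0 i - q 0 i) ^+ 2).

Section EuclideanMetric.
Context (R : realType) (N : nat).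
Implicit Types (p q r : euclidean R N) (a b : 'I_N -> R).

HB.instance Definition _ := GRing.Lmodule.copy (euclidean R N) 'rV[R]_N.

Let sumsq a : R := \sum_(i < N) a i ^+ 2.

Let sumsq_ge0 a : 0 <= sumsq a.
Proof. by apply: sumr_ge0 => i _; exact: sqr_ge0. Qed.

Let cauchy_schwarz a b :
  \sum_(i < N) a i * b i <= Num.sqrt (sumsq a) * Num.sqrt (sumsq b).
Proof.
set S := \sum_(i < N) _.
have disc (x y : R) : 2 * x * y * S <= x ^+ 2 * sumsq a + y ^+ 2 * sumsq b.
  rewrite /S /sumsq !mulr_sumr -big_split /=; apply: ler_sum => i _.
  have := sqr_ge0 (x * a i - y * b i); nra.
have A0 := sqrtr_ge0 (sumsq a); have B0 := sqrtr_ge0 (sumsq b).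
have := disc (Num.sqrt (sumsq b)) (Num.sqrt (sumsq a)).
have := sqr_sqrtr (sumsq_ge0 a); have := sqr_sqrtr (sumsq_ge0 b).
move: A0 B0; set A := Num.sqrt (sumsq a); set B := Num.sqrt (sumsq b).
move=> A0 B0 <- <-; have [AB|AB] := eqVneq (A * B) 0; last first.
  have AB0 : 0 < A * B by rewrite lt_def AB mulr_ge0.
  by move=> h; rewrite -(ler_pM2l AB0); lra.
move=> _; rewrite AB; have := sqr_sqrtr (sumsq_ge0 a).
have := sqr_sqrtr (sumsq_ge0 b); rewrite -/A -/B.
move: AB => /eqP; rewrite mulf_eq0 => /orP[] /eqP -> hb ha.
- suff -> : S = 0 by [].
  apply: big1 => i _; move: ha => /esym/eqP; rewrite expr0n /= psumr_eq0.
    by move=> /allP/(_ i (mem_index_enum _)); rewrite sqrf_eq0 => /eqP ->; rewrite mul0r.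
  by move=> j _; exact: sqr_ge0.
- suff -> : S = 0 by [].
  apply: big1 => i _; move: hb => /esym/eqP; rewrite expr0n /= psumr_eq0.
    by move=> /allP/(_ i (mem_index_enum _)); rewrite sqrf_eq0 => /eqP ->; rewrite mulr0.
  by move=> j _; exact: sqr_ge0.
Qed.

Lemma euclidean_distxx p : euclidean_dist p p = 0.
Proof.
by rewrite /euclidean_dist big1 ?sqrtr0 // => i _; rewrite subrr expr0n.
Qed.

Lemma euclidean_dist_positivity p q : euclidean_dist p q = 0 -> p = q.
Proof.
move=> /eqP; rewrite sqrtr_eq0 => h.
have : \sum_(i < N) (p 0 i - q 0 i) ^+ 2 == 0.
  by rewrite eq_le h sumr_ge0 // => i _; exact: sqr_ge0.
rewrite psumr_eq0; last by move=> i _; exact: sqr_ge0.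
move=> /allP h0; apply/rowP => i.
have := h0 i (mem_index_enum _).
by rewrite sqrf_eq0 subr_eq0 => /eqP.
Qed.

Lemma euclidean_dist_sym p q : euclidean_dist p q = euclidean_dist q p.
Proof.
by congr Num.sqrt; apply: eq_bigr => i _; rewrite -sqrrN opprB.
Qed.

Lemma euclidean_dist_triangle q p r :
  euclidean_dist p r <= euclidean_dist p q + euclidean_dist q r.
Proof.
pose a i := p 0 i - q 0 i; pose b i := q 0 i - r 0 i.
have := cauchy_schwarz a b.
rewrite -[euclidean_dist p q]/(Num.sqrt (sumsq a)).
rewrite -[euclidean_dist q r]/(Num.sqrt (sumsq b)).
have A0 := sqrtr_ge0 (sumsq a); have B0 := sqrtr_ge0 (sumsq b) => AB.
rewrite -[leRHS]ger0_norm ?addr_ge0 // -sqrtr_sqr ler_wsqrtr //.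
rewrite sqrrD !sqr_sqrtr //.
have -> : \sum_(i < N) (p 0 i - r 0 i) ^+ 2 =
    sumsq a + (\sum_(i < N) a i * b i) *+ 2 + sumsq b.
  rewrite /sumsq -sumrMnl -!big_split /=; apply: eq_bigr => i _.
  by rewrite /a /b; ring.
by rewrite lerD2r lerD2l lerMn2r.
Qed.

HB.instance Definition _ := isMetric.Build R (euclidean R N)
  euclidean_distxx euclidean_dist_positivity euclidean_dist_sym
  euclidean_dist_triangle.

End EuclideanMetric.

Section Curves.
Context (R : realType) (X : metricType R).
Implicit Types (A : set X) (g : R -> X) (x y z : X).

(* Length of [g] on [0, 1]: supremum of the lengths of the inscribed polygonal
   lines with vertices [g (t 0), ..., g (t m)], [0 <= t 0 <= ... <= t m <= 1]. *)
Definition curve_length g : \bar R :=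
  ereal_sup [set L | exists (t : nat -> R) (m : nat),
    [/\ {homo t : i j / (i <= j)%N >-> i <= j},
        forall i, t i \in `[0, 1] &
        L = (\sum_(i < m) mdist (g (t i)) (g (t i.+1)))%:E]].

Definition path_in A x y g : Prop :=
  [/\ {within `[0, 1], continuous g}, forall t, t \in `[0, 1] -> A (g t),
      g 0 = x & g 1 = y].

Definition path_edist A x y : \bar R :=
  ereal_inf [set curve_length g | g in path_in A x y].

Definition path_dist A x y : R := fine (path_edist A x y).

End Curves.

Section CurvesTheory.
Context (R : realType) (X : metricType R).
Implicit Types (A : set X) (g h : R -> X) (x y z : X).

Lemma within_unit_continuousP g :
  {within `[0, 1], continuous g} <->
  forall s e, s \in `[0, 1] -> 0 < e -> exists2 d, 0 < d &
    forall t, t \in `[0, 1] -> `|s - t| < d -> mdist (g s) (g t) < e.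
Proof.
split.
- move=> /subspace_continuousP cg s e s01 e0.
  have /cg/cvg_ballP/(_ e e0) : [set` `[0%R, 1%R]] s by [].
  rewrite near_withinE => -[d d0 hd]; exists d => // t t01 st.
  by have := hd t st t01; rewrite /= ballEmdist.
- move=> h; apply/subspace_continuousP => s s01; apply/cvg_ballP => e e0.
  have [d d0 hd] := h s e s01 e0.
  rewrite near_withinE; exists d => // t /= st t01.
  by rewrite ballEmdist /=; exact: hd.
Qed.

Lemma curve_length_ub g L :
  (forall (t : nat -> R) m, {homo t : i j / (i <= j)%N >-> i <= j} ->
    (forall i, t i \in `[0, 1]) ->
    ((\sum_(i < m) mdist (g (t i)) (g (t i.+1)))%:E <= L)%E) ->
  (curve_length g <= L)%E.
Proof.
by move=> h; apply: ge_ereal_sup => _ [t [m [tm t01 ->]]]; exact: h.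
Qed.

Lemma curve_length_lb g (t : nat -> R) m :
  {homo t : i j / (i <= j)%N >-> i <= j} ->
  (forall i, t i \in `[0, 1]) ->
  ((\sum_(i < m) mdist (g (t i)) (g (t i.+1)))%:E <= curve_length g)%E.
Proof. by move=> tm t01; apply: ereal_sup_ubound; exists t, m. Qed.

Lemma curve_length_ge_dist g : ((mdist (g 0) (g 1))%:E <= curve_length g)%E.
Proof.
pose t i : R := (0 < i)%N%:R.
have -> : mdist (g 0) (g 1) = \sum_(i < 1) mdist (g (t i)) (g (t i.+1)).
  by rewrite big_ord1.
apply: curve_length_lb; first by move=> [|i] [|j].
by move=> i; rewrite in_itv /= /t; case: i => [|i] /=; rewrite ?lexx ?ler01.
Qed.

Lemma lipschitz_curve_length g L :
  0 <= L -> (forall s t, s \in `[0, 1] -> t \in `[0, 1] ->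
    mdist (g s) (g t) <= L * `|s - t|) ->
  {within `[0, 1], continuous g} /\ (curve_length g <= L%:E)%E.
Proof.
move=> L0 gL; split.
  apply/within_unit_continuousP => s e s01 e0; exists (e / (L + 1)).
    by rewrite divr_gt0 // ltr_wpDl.
  move=> t t01; rewrite ltr_pdivlMr ?ltr_wpDl // => st.
  apply: le_lt_trans (gL _ _ s01 t01) _; apply: le_lt_trans _ st.
  by rewrite mulrDr mulr1 [L * _]mulrC lerDl.
apply: curve_length_ub => t m tm t01; rewrite lee_fin.
apply: (@le_trans _ _ (\sum_(i < m) (L * t i.+1 - L * t i))).
  apply: ler_sum => i _; apply: le_trans (gL _ _ (t01 _) (t01 _)) _.
  by rewrite -mulrBr distrC ger0_norm // subr_ge0 tm.
rewrite -(big_mkord xpredT (fun i => L * t i.+1 - L * t i)) telescope_sumr //.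
have := t01 m; have := t01 0%N; rewrite !in_itv /= => /andP[a b] /andP[c d].
nra.
Qed.

Lemma path_edist_ge_dist A x y : ((mdist x y)%:E <= path_edist A x y)%E.
Proof.
apply: le_ereal_inf_tmp => _ [g [_ _ <- <-] <-].
exact: curve_length_ge_dist.
Qed.

Lemma path_edist_ge0 A x y : (0 <= path_edist A x y)%E.
Proof. by apply: le_trans (path_edist_ge_dist A x y); rewrite lee_fin mdist_ge0. Qed.

Lemma path_edistxx A x : A x -> path_edist A x x = 0%E.
Proof.
move=> Ax; apply/eqP; rewrite eq_le path_edist_ge0 andbT.
have [|c l] := @lipschitz_curve_length (fun=> x) 0 (lexx _).
  by move=> s t _ _; rewrite mdistxx mul0r.
by apply: le_trans l; apply: ereal_inf_lbound; exists (fun=> x).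
Qed.

Let rev_sub A x y : (path_edist A y x <= path_edist A x y)%E.
Proof.
have rev01 (t : R) : t \in `[0, 1] -> 1 - t \in `[0, 1].
  by rewrite !in_itv /= => /andP[a b]; apply/andP; split; lra.
apply: le_ereal_inf_tmp => _ [g [/within_unit_continuousP gc gA g0 g1] <-].
pose r t := g (1 - t).
apply: (@le_trans _ _ (curve_length r)).
  apply: ereal_inf_lbound; exists r => //; split.
  - apply/within_unit_continuousP => s e s01 e0.
    have [d d0 hd] := gc _ _ (rev01 _ s01) e0; exists d => // t t01 st.
    apply: hd; first exact: rev01.
    have -> : 1 - s - (1 - t) = - (s - t) by ring.
    by rewrite normrN.
  - by move=> t /rev01; exact: gA.
  - by rewrite /r subr0.
  - by rewrite /r subrr.
apply: curve_length_ub => t m tm t01.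
pose u i := 1 - t (m - i)%N.
have -> : \sum_(i < m) mdist (r (t i)) (r (t i.+1)) =
          \sum_(i < m) mdist (g (u i)) (g (u i.+1)).
  rewrite [RHS](reindex_inj rev_ord_inj) /=; apply: eq_bigr => i _.
  rewrite metric_sym /u /r subnSK // subKn // ?subKn //; last exact: ltnW.
apply: curve_length_lb.
- by move=> i j ij; rewrite /u lerB // tm // leq_sub2l.
- by move=> i; exact: rev01.
Qed.

Lemma path_edist_sym A x y : path_edist A x y = path_edist A y x.
Proof. by apply/eqP; rewrite eq_le !rev_sub. Qed.

Let glue g h t := if t <= 2^-1 then g (2 * t) else h (2 * t - 1).

Let glue_length g h : g 1 = h 0 ->
  (curve_length (glue g h) <= curve_length g + curve_length h)%E.
Proof.
move=> gh; apply: curve_length_ub => t m tm t01.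
pose u i := Num.min (2 * t i) 1; pose v i := Num.max (2 * t i - 1) 0.
have um : {homo u : i j / (i <= j)%N >-> i <= j}.
  move=> i j /tm ij; rewrite /u le_min !ge_min lexx orbT andbT.
  by apply/orP; left; lra.
have vm : {homo v : i j / (i <= j)%N >-> i <= j}.
  move=> i j /tm ij; rewrite /v ge_max !le_max lexx orbT andbT.
  by apply/orP; left; lra.
have u01 i : u i \in `[0, 1].
  have := t01 i; rewrite !in_itv /= => /andP[a b].
  by rewrite /u le_min ge_min lexx orbT ler01 !andbT; lra.
have v01 i : v i \in `[0, 1].
  have := t01 i; rewrite !in_itv /= => /andP[a b].
  by rewrite /v ge_max le_max lexx orbT ler01 !andbT; lra.
apply: le_trans (leeD (curve_length_lb g m um u01) (curve_length_lb h m vm v01)).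
rewrite -EFinD lee_fin -big_split /=; apply: ler_sum => i _.
have tii : t i <= t i.+1 by exact: tm.
rewrite /glue /u /v; have [a|a] := leP (t i) 2^-1; have [b|b] := leP (t i.+1) 2^-1.
- have -> : Num.min (2 * t i) 1 = 2 * t i by apply: min_l; lra.
  have -> : Num.min (2 * t i.+1) 1 = 2 * t i.+1 by apply: min_l; lra.
  by rewrite lerDl mdist_ge0.
- have -> : Num.min (2 * t i) 1 = 2 * t i by apply: min_l; lra.
  have -> : Num.min (2 * t i.+1) 1 = 1 by apply: min_r; lra.
  have -> : Num.max (2 * t i - 1) 0 = 0 by apply: max_r; lra.
  have -> : Num.max (2 * t i.+1 - 1) 0 = 2 * t i.+1 - 1 by apply: max_l; lra.
  by rewrite gh; exact: metric_triangle.
- by have := lt_le_trans a (le_trans tii b); rewrite ltxx.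
- have -> : Num.max (2 * t i - 1) 0 = 2 * t i - 1 by apply: max_l; lra.
  have -> : Num.max (2 * t i.+1 - 1) 0 = 2 * t i.+1 - 1 by apply: max_l; lra.
  by rewrite lerDr mdist_ge0.
Qed.

Let glue_path A x y z g h :
  path_in A x y g -> path_in A y z h -> path_in A x z (glue g h).
Proof.
move=> [/within_unit_continuousP gc gA g0 g1] [/within_unit_continuousP hc hA h0 h1].
have half (b : bool) (t : R) : t \in `[0, 1] ->
    if b then t <= 2^-1 -> 2 * t \in `[0, 1] else 2^-1 <= t -> 2 * t - 1 \in `[0, 1].
  by rewrite in_itv /= => /andP[a c]; case: b => d; rewrite in_itv /=; apply/andP; split; lra.
have halfg t := half true t; have halfh t := half false t => {half} /=.
split.
- apply/within_unit_continuousP => s e s01 e0; rewrite /glue.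
  case: (ltgtP s 2^-1) => [s2|s2|s2].
  + have [d d0 hd] := gc _ _ (halfg _ s01 (ltW s2)) e0.
    exists (Num.min (d / 2) (2^-1 - s)); first by rewrite lt_min; apply/andP; split; lra.
    move=> t t01; rewrite lt_min => /andP[st1 st2].
    have t2 : t <= 2^-1 by move: st2; rewrite ltr_norml => /andP[]; lra.
    rewrite t2; apply: hd; first exact: halfg.
    by rewrite -mulrBr normrM ger0_norm //; lra.
  + have [d d0 hd] := hc _ _ (halfh _ s01 (ltW s2)) e0.
    exists (Num.min (d / 2) (s - 2^-1)); first by rewrite lt_min; apply/andP; split; lra.
    move=> t t01; rewrite lt_min => /andP[st1 st2].
    have t2 : 2^-1 < t by move: st2; rewrite ltr_norml => /andP[]; lra.
    rewrite leNgt t2 /=; apply: hd; first exact: halfh (ltW t2).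
    have -> : 2 * s - 1 - (2 * t - 1) = 2 * (s - t) by ring.
    by rewrite normrM ger0_norm //; lra.
  + have s2' : s <= 2^-1 by rewrite s2.
    have s2'' : 2^-1 <= s by rewrite s2.
    have [d d0 hd] := gc _ _ (halfg _ s01 s2') e0.
    have [d' d0' hd'] := hc _ _ (halfh _ s01 s2'') e0.
    exists (Num.min (d / 2) (d' / 2)); first by rewrite lt_min; apply/andP; split; lra.
    move=> t t01; rewrite lt_min => /andP[st1 st2].
    have [t2|t2] := leP t 2^-1.
      apply: hd; first exact: halfg.
      by rewrite -mulrBr normrM ger0_norm //; lra.
    have -> : g (2 * s) = h (2 * s - 1).
      by rewrite s2 divff // subrr g1 h0.
    apply: hd'; first exact: halfh (ltW t2).
    have -> : 2 * s - 1 - (2 * t - 1) = 2 * (s - t) by ring.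
    by rewrite normrM ger0_norm //; lra.
- move=> t t01; rewrite /glue; case: leP => t2; first exact/gA/halfg.
  exact/hA/halfh/ltW.
- by rewrite /glue mulr0 invr_ge0 ler0n.
- rewrite /glue; have -> : (1 <= 2^-1 :> R) = false by apply/negbTE; rewrite -ltNge; lra.
  by rewrite mulr1 -h1; congr h; ring.
Qed.

Lemma path_edist_triangle A x y z :
  (path_edist A x z <= path_edist A x y + path_edist A y z)%E.
Proof.
have h0 B (a b : X) : path_edist B a b != -oo%E.
  by rewrite gt_eqF // (lt_le_trans _ (path_edist_ge0 _ _ _)) // ltNy0.
have [->|xy] := eqVneq (path_edist A x y) +oo%E.
  by rewrite addye ?h0 // leey.
have [->|yz] := eqVneq (path_edist A y z) +oo%E.
  by rewrite addey ?h0 // leey.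
have fxy : path_edist A x y \is a fin_num by rewrite fin_numE h0 xy.
have fyz : path_edist A y z \is a fin_num by rewrite fin_numE h0 yz.
apply/lee_addgt0Pr => e e0; have e2 : 0 < e / 2 by rewrite divr_gt0.
have [_ [g pg <-] gl] := lb_ereal_inf_adherent e2 fxy.
have [_ [h ph <-] hl] := lb_ereal_inf_adherent e2 fyz.
apply: (@le_trans _ _ (curve_length g + curve_length h)%E).
  apply: le_trans (glue_length _); last by case: pg => _ _ _ ->; case: ph.
  by apply: ereal_inf_lbound; exists (glue g h) => //; exact: glue_path ph.
have -> : (path_edist A x y + path_edist A y z + e%:E =
  (path_edist A x y + (e / 2)%:E) + (path_edist A y z + (e / 2)%:E))%E.
  by rewrite addeACA -EFinD -splitr.
by apply: leeD; exact: ltW.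
Qed.

End CurvesTheory.

Section SlitCarpet.
Context (R : realType).

Definition unit_square : set (euclidean R 2) :=
  [set p | 0 <= p 0 0 <= 1 /\ 0 <= p 0 1 <= 1].

Definition slit (n l k : nat) : set (euclidean R 2) :=
  [set p | p 0 0 = (2 * l + 1)%:R / 2 ^+ n.+1 /\
           (4 * k + 1)%:R / 2 ^+ n.+2 <= p 0 1 <= (4 * k + 3)%:R / 2 ^+ n.+2].

Fixpoint carpet (n : nat) : set (euclidean R 2) :=
  if n is m.+1 then
    carpet m `\` \bigcup_(l in `I_(2 ^ n)) \bigcup_(k in `I_(2 ^ n)) slit n l k
  else unit_square.

End SlitCarpet.

Section SlitCarpetMetric.
Context (R : realType).
Implicit Types (p q r : euclidean R 2) (A : set (euclidean R 2)).

Let seg p q (t : R) : euclidean R 2 := (1 - t) *: p + t *: q.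

Let segE p q t i : seg p q t 0 i = (1 - t) * p 0 i + t * q 0 i.
Proof. by rewrite !mxE. Qed.

Let seg_dist p q s t : mdist (seg p q s) (seg p q t) <= mdist p q * `|s - t|.
Proof.
rewrite -[leLHS]/(Num.sqrt _) -[mdist p q]/(Num.sqrt _) -sqrtr_sqr -sqrtrM.
  rewrite mulr_suml ler_wsqrtr // le_eqVlt; apply/orP; left; apply/eqP.
  by apply: eq_bigr => i _; rewrite !segE; ring.
by apply: sumr_ge0 => i _; exact: sqr_ge0.
Qed.

Let seg_fin A p q : (forall t, t \in `[0, 1] -> A (seg p q t)) ->
  (path_edist A p q < +oo)%E.
Proof.
move=> sA; have [|c l] := @lipschitz_curve_length _ _ (seg p q) (mdist p q) (mdist_ge0 _ _).
  by move=> s t _ _; exact: seg_dist.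
apply: le_lt_trans (ltry (mdist p q)); apply: le_trans l.
apply: ereal_inf_lbound; exists (seg p q) => //; split=> //.
- by rewrite /seg subr0 scale1r scale0r addr0.
- by rewrite /seg subrr scale1r scale0r add0r.
Qed.

Lemma carpetP n p : carpet n p <-> unit_square p /\
  forall m l k, (0 < m <= n)%N -> (l < 2 ^ m)%N -> (k < 2 ^ m)%N ->
    ~ slit m l k p.
Proof.
elim: n => [|n IH] /=.
  split=> [|[]//] sp; split=> // m l k /andP[m0]; rewrite leqNgt.
  by rewrite m0.
split.
- move=> [/IH[sp h] nb]; split=> // m l k /andP[m0]; rewrite leq_eqVlt ltnS.
  case/orP=> [/eqP -> ln kn sl|mn]; last by apply: h; rewrite m0.
  by apply: nb; exists l => //; exists k.
- move=> [sp h]; split.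
    apply/IH; split=> // m l k /andP[m0 mn]; apply: h.
    by rewrite m0 (leq_trans mn).
  by move=> [l /= ln [k /= kn sl]]; apply: (h n.+1 l k); rewrite //= leqnn.
Qed.

Let slit_grid n m l k p : (0 < m <= n)%N -> (l < 2 ^ m)%N -> slit m l k p ->
  [/\ exists z : nat, p 0 0 * 2 ^+ n.+1 = z%:R, p 0 0 < 1 & 0 < p 0 1].
Proof.
move=> /andP[m0 mn] lm [px /andP[py _]].
have D0 i : 0 < 2 ^+ i :> R by rewrite exprn_gt0.
split.
- exists ((2 * l + 1) * 2 ^ (n - m))%N.
  have -> : n.+1 = (m.+1 + (n - m))%N by rewrite addSn subnKC.
  by rewrite px exprD mulrA divfK ?gt_eqF // natrM natrX.
- rewrite px ltr_pdivrMr // mul1r -natrX ltr_nat expnS.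
  by rewrite -(ltn_pmul2l (isT : 0 < 2)%N) in lm; lia.
- by apply: lt_le_trans py; rewrite divr_gt0 // ltr0n addn1.
Qed.

Let off_grid n p : unit_square p ->
  [\/ forall z : nat, p 0 0 * 2 ^+ n.+1 <> z%:R, p 0 0 = 1 | p 0 1 = 0] ->
  carpet n p.
Proof.
move=> sp h; apply/carpetP; split=> // m l k mn lm km sl.
have [[z hz] x1 y0] := slit_grid mn lm sl.
by case: h => [/(_ z)//|x|y]; [rewrite x ltxx in x1|rewrite y ltxx in y0].
Qed.

Let pt (a b : R) : euclidean R 2 := \row_j (if j == 0 then a else b).
Let pt0 a b : pt a b 0 0 = a. Proof. by rewrite mxE. Qed.
Let pt1 a b : pt a b 0 1 = b. Proof. by rewrite mxE. Qed.

Let vertical_fin n (x y : R) :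
  0 <= x <= 1 -> 0 <= y <= 1 ->
  (forall z : nat, x * 2 ^+ n.+1 <> z%:R) \/ x = 1 ->
  (path_edist (carpet n) (pt x y) (pt 0 0) < +oo)%E.
Proof.
move=> x01 y01 hx.
have half : (path_edist (carpet n) (pt x y) (pt x 0) < +oo)%E.
  apply: seg_fin => t; rewrite in_itv /= => /andP[t0 t1].
  have e0 : seg (pt x y) (pt x 0) t 0 0 = x by rewrite segE !pt0; ring.
  have e1 : seg (pt x y) (pt x 0) t 0 1 = (1 - t) * y by rewrite segE !pt1; ring.
  apply: off_grid; first by split; rewrite ?e0 ?e1 //; nra.
  by rewrite e0; case: hx; [constructor 1|constructor 2].
apply: le_lt_trans (path_edist_triangle _ _ (pt x 0) _) _.
apply: lte_add_pinfty => //.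
apply: seg_fin => t; rewrite in_itv /= => /andP[t0 t1].
have e0 : seg (pt x 0) (pt 0 0) t 0 0 = (1 - t) * x by rewrite segE !pt0; ring.
have e1 : seg (pt x 0) (pt 0 0) t 0 1 = 0 by rewrite segE !pt1; ring.
apply: off_grid; last by constructor 3.
by split; rewrite ?e0 ?e1 ?lexx ?ler01 //; nra.
Qed.

Let origin_fin n p : carpet n p ->
  (path_edist (carpet n) p (pt 0 0) < +oo)%E.
Proof.
move=> cp; have [[x01 y01] _] := (carpetP n p).1 cp.
have -> : p = pt (p 0 0) (p 0 1).
  apply/rowP => i; rewrite mxE; case: eqP => [->//|/eqP].
  by case: i => [[|[|]]] //= h _; congr (p _ _); apply: val_inj.
have pE := pt0 (p 0 0) (p 0 1).
move: x01 y01; set x := p 0 0; set y := p 0 1 => x01 y01.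
have [->|x1] := eqVneq x 1; first by apply: vertical_fin; [lra|lra|right].
have {x1} x1 : x < 1 by rewrite lt_neqAle x1; lra.
have x0 : 0 <= x by lra.
pose D : R := 2 ^+ n.+1; have D0 : 0 < D by rewrite exprn_gt0.
pose j := Num.truncn (x * D).
have /andP[jl ju] : j%:R <= x * D < j.+1%:R.
  by apply: truncn_itv; rewrite mulr_ge0 // ltW.
have jD : j.+1%:R <= D.
  have : j%:R < (2 ^ n.+1)%:R :> R.
    by apply: le_lt_trans jl _; rewrite natrX; rewrite -/D; nra.
  by rewrite ltr_nat => jn; rewrite /D -natrX ler_nat.
move: ju jD; rewrite -natr1 => ju jD.
pose x' := (j%:R + 2^-1) / D.
have x'D : x' * D = j%:R + 2^-1 by rewrite divfK // gt_eqF.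
have j0 : 0 <= j%:R :> R by rewrite ler0n.
have x'01 : 0 <= x' <= 1.
  apply/andP; split; first by rewrite divr_ge0 ?(ltW D0) //; lra.
  by rewrite ler_pdivrMr // mul1r; lra.
apply: le_lt_trans (path_edist_triangle _ _ (pt x' y) _) _.
apply: lte_add_pinfty; last first.
  apply: vertical_fin => //; left => z; rewrite [_ * _]x'D => /(congr1 (fun u => u * 2)).
  rewrite mulrDl mulVf // -natrM -natrM natr1 => /eqP; rewrite eqr_nat => /eqP.
  lia.
apply: seg_fin => t; rewrite in_itv /= => /andP[t0 t1].
set r := seg _ _ t.
have e0 : r 0 0 = (1 - t) * x + t * x' by rewrite segE !pt0.
have e1 : r 0 1 = y by rewrite segE !pt1; ring.
have [{}t0|tn0] := eqVneq t 0.
  have -> : r = p.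
    rewrite /r /seg t0 subr0 scale1r scale0r addr0.
    apply/rowP => i; rewrite mxE; case: eqP => [->//|/eqP].
    by case: i => [[|[|]]] //= h _; congr (p _ _); apply: val_inj.
  exact: cp.
have tp : 0 < t by rewrite lt_def tn0.
apply: off_grid; first by split; rewrite ?e0 ?e1 //; nra.
constructor 1 => z; rewrite e0.
have -> : ((1 - t) * x + t * x') * 2 ^+ n.+1 =
    (1 - t) * (x * D) + t * (j%:R + 2^-1) by rewrite -x'D /D; ring.
move=> hz.
have : j%:R < z%:R :> R by rewrite -hz; nra.
have : z%:R < j.+1%:R :> R by rewrite -hz -(natr1 j); nra.
rewrite !ltr_nat ltnS => zj jz.
by have := leq_ltn_trans zj jz; rewrite ltnn.
Qed.

Lemma carpet_edist_fin n p q : carpet n p -> carpet n q ->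
  path_edist (carpet n) p q \is a fin_num.
Proof.
move=> cp cq; rewrite ge0_fin_numE ?path_edist_ge0 //.
apply: le_lt_trans (path_edist_triangle _ _ (pt 0 0) _) _.
apply: lte_add_pinfty; first exact: origin_fin.
by rewrite path_edist_sym; exact: origin_fin.
Qed.

(* A type of its own for the points of [carpet n], carrying the path metric: the
   library already gives the subtype [carpet n] the restricted topology. *)
Definition carpet_space (n : nat) : Type := set_type (@carpet R n).

HB.instance Definition _ n := Choice.on (carpet_space n).

Section PathMetric.
Variable n : nat.
Implicit Types u v w : carpet_space n.

Definition carpet_dist u v : R := path_dist (@carpet R n) (val u) (val v).

Let edist_fin u v : path_edist (@carpet R n) (val u) (val v) \is a fin_num.
Proof. by apply: carpet_edist_fin; apply/set_mem/valP. Qed.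

Lemma carpet_distxx u : carpet_dist u u = 0.
Proof. by rewrite /carpet_dist /path_dist path_edistxx //; apply/set_mem/valP. Qed.

Lemma carpet_dist_positivity u v : carpet_dist u v = 0 -> u = v.
Proof.
move=> uv; apply: val_inj; apply: mdist_positivity; apply/eqP.
rewrite eq_le mdist_ge0 andbT -uv -lee_fin fineK //.
exact: path_edist_ge_dist.
Qed.

Lemma carpet_dist_sym u v : carpet_dist u v = carpet_dist v u.
Proof. by rewrite /carpet_dist /path_dist path_edist_sym. Qed.

Lemma carpet_dist_triangle v u w :
  carpet_dist u w <= carpet_dist u v + carpet_dist v w.
Proof.
by rewrite -lee_fin EFinD !fineK //; exact: path_edist_triangle.
Qed.

HB.instance Definition _ := isMetric.Build R (carpet_space n)
  carpet_distxx carpet_dist_positivity carpet_dist_sym carpet_dist_triangle.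

End PathMetric.

End SlitCarpetMetric.

Section Completion.
Local Open Scope quotient_scope.
Context (R : realType) (X : metricType R).

Record cauchy_seq : Type := CauchySeq {
  cauchy_seq_val :> nat -> X ;
  cauchy_seqP : cauchy (cauchy_seq_val @ \oo) }.

HB.instance Definition _ := gen_eqMixin cauchy_seq.
HB.instance Definition _ := gen_choiceMixin cauchy_seq.

Implicit Types u v w : cauchy_seq.

Definition seq_dist u v : R := lim (mdist (u k) (v k) @[k --> \oo]).

Lemma cauchy_seq_mdist u (e : R) : 0 < e ->
  exists K, forall i j, (K <= i)%N -> (K <= j)%N -> mdist (u i) (u j) < e.
Proof.
move=> e0; have /cauchy_ballP/(_ e e0) := (@cauchy_seqP u).
move=> [[A B] /= [[K1 _ h1] [K2 _ h2]] AB].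
exists (maxn K1 K2) => i j; rewrite !geq_max => /andP[i1 _] /andP[_ j2].
have := AB (u i, u j); rewrite /= ballEmdist /=; apply; split; [exact: h1|exact: h2].
Qed.

Lemma seq_dist_cvg u v : mdist (u k) (v k) @[k --> \oo] --> seq_dist u v.
Proof.
apply: cauchy_cvg; apply/cauchy_ballP => e e0.
have e2 : 0 < e / 2 by rewrite divr_gt0.
have [K1 h1] := cauchy_seq_mdist u e2; have [K2 h2] := cauchy_seq_mdist v e2.
exists ([set x | exists2 i, (maxn K1 K2 <= i)%N & x = mdist (u i) (v i)],
        [set x | exists2 i, (maxn K1 K2 <= i)%N & x = mdist (u i) (v i)]).
  by split; exists (maxn K1 K2) => // i /= Ki; exists i.
move=> [x y] /= [[i Ki ->] [j Kj ->]].
move: Ki Kj; rewrite !geq_max => /andP[i1 i2] /andP[j1 j2].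
rewrite /ball /= ltr_norml; apply/andP; split.
- have a := metric_triangle (u j) (u i) (v j).
  have b := metric_triangle (u i) (v i) (v j).
  by have := h1 _ _ j1 i1; have := h2 _ _ i2 j2; lra.
- have a := metric_triangle (u i) (u j) (v i).
  have b := metric_triangle (u j) (v j) (v i).
  by have := h1 _ _ i1 j1; have := h2 _ _ j2 i2; lra.
Qed.

Lemma seq_dist_ge0 u v : 0 <= seq_dist u v.
Proof.
apply: limr_ge; first by apply: cvgP; exact: seq_dist_cvg.
by apply: nearW => k; exact: mdist_ge0.
Qed.

Lemma seq_distxx u : seq_dist u u = 0.
Proof.
rewrite /seq_dist; under eq_fun do rewrite mdistxx.
exact: lim_cst.
Qed.

Lemma seq_dist_sym u v : seq_dist u v = seq_dist v u.
Proof. by rewrite /seq_dist; under eq_fun do rewrite metric_sym. Qed.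

Lemma seq_dist_triangle v u w : seq_dist u w <= seq_dist u v + seq_dist v w.
Proof.
have h : mdist (u k) (v k) + mdist (v k) (w k) @[k --> \oo] -->
    seq_dist u v + seq_dist v w by apply: cvgD; exact: seq_dist_cvg.
rewrite -(cvg_lim _ h) //; apply: ler_lim.
- by apply: cvgP; exact: seq_dist_cvg.
- exact: cvgP h.
- by apply: nearW => k; exact: metric_triangle.
Qed.

Definition seq_equiv u v : bool := seq_dist u v == 0.

Let seq_equiv_refl : reflexive seq_equiv.
Proof. by move=> u; rewrite /seq_equiv seq_distxx. Qed.

Let seq_equiv_sym : symmetric seq_equiv.
Proof. by move=> u v; rewrite /seq_equiv seq_dist_sym. Qed.

Let seq_equiv_trans : transitive seq_equiv.
Proof.
move=> v u w /eqP uv /eqP vw; rewrite /seq_equiv eq_le seq_dist_ge0 andbT.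
by have := seq_dist_triangle v u w; rewrite uv vw addr0.
Qed.

Canonical seq_equiv_rel :=
  EquivRel seq_equiv seq_equiv_refl seq_equiv_sym seq_equiv_trans.

(* Metric completion: Cauchy sequences modulo distance zero, with the limit
   distance. *)
Definition completion : Type := {eq_quot seq_equiv_rel}%qT.

HB.instance Definition _ := Choice.on completion.
HB.instance Definition _ := EqQuotient.on completion.

Implicit Types a b c : completion.

Definition completion_dist a b : R := seq_dist (repr a) (repr b).

Lemma completion_distxx a : completion_dist a a = 0.
Proof. exact: seq_distxx. Qed.

Lemma completion_dist_positivity a b : completion_dist a b = 0 -> a = b.
Proof.
move=> ab; rewrite -[a]reprK -[b]reprK; apply/eqmodP.
by rewrite /= /seq_equiv; apply/eqP.
Qed.

Lemma completion_dist_sym a b : completion_dist a b = completion_dist b a.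
Proof. exact: seq_dist_sym. Qed.

Lemma completion_dist_triangle b a c :
  completion_dist a c <= completion_dist a b + completion_dist b c.
Proof. exact: seq_dist_triangle. Qed.

HB.instance Definition _ := isMetric.Build R completion
  completion_distxx completion_dist_positivity completion_dist_sym
  completion_dist_triangle.

Lemma completion_distE u v :
  mdist (\pi_completion u) (\pi_completion v) = seq_dist u v.
Proof.
have e w : seq_dist (repr (\pi_completion w)) w = 0.
  by apply/eqP; have /eqmodP : \pi_completion (repr (\pi_completion w)) = \pi_completion w
     by rewrite reprK.
have e' w : seq_dist w (repr (\pi_completion w)) = 0 by rewrite seq_dist_sym.
rewrite -[LHS]/(seq_dist _ _); apply/eqP; rewrite eq_le; apply/andP; split.
- apply: le_trans (seq_dist_triangle u _ _) _; rewrite e add0r.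
  by apply: le_trans (seq_dist_triangle v _ _) _; rewrite e' addr0.
- apply: le_trans (seq_dist_triangle (repr (\pi_completion u)) _ _) _.
  rewrite e' add0r.
  by apply: le_trans (seq_dist_triangle (repr (\pi_completion v)) _ _) _; rewrite e addr0.
Qed.

Lemma cauchy_cst (x : X) : cauchy ((fun=> x) @ \oo).
Proof.
apply/cauchy_ballP => e e0; exists ([set x], [set x]).
  by split; exists 0%N.
by move=> [y z] [/= -> ->]; exact: ballxx.
Qed.

Definition completion_in (x : X) : completion :=
  \pi_completion (CauchySeq (cauchy_cst x)).

Lemma completion_in_isometry x y :
  mdist (completion_in x) (completion_in y) = mdist x y.
Proof. by rewrite completion_distE; rewrite /seq_dist /=; exact: lim_cst. Qed.

Lemma cvg_completion_in u :
  completion_in (u k) @[k --> \oo] --> \pi_completion u.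
Proof.
apply/cvg_ballP => e e0; have e2 : 0 < e / 2 by lra.
have [K h] := cauchy_seq_mdist u e2; exists K => // k /= Kk.
rewrite ballEmdist /= completion_distE.
apply: (@le_lt_trans _ _ (e / 2)); last by lra.
apply: limr_le; first by apply: cvgP; exact: seq_dist_cvg.
by exists K => // i /= Ki; exact/ltW/h.
Qed.

Lemma completion_in_approx a (e : R) : 0 < e ->
  exists x, mdist a (completion_in x) < e.
Proof.
move=> e0; have /cvg_ballP/(_ e e0) [K _ h] := cvg_completion_in (u := repr a).
exists (repr a K); have := h K (leqnn K).
by rewrite /= ballEmdist /= reprK.
Qed.

Lemma completion_complete (F : set_system completion) :
  ProperFilter F -> cauchy F -> exists a : completion, F --> a.
Proof.
move=> FF /cauchyP Fc.
have arith (p q r A B dK dK1 e : R) : 0 < e / 4 -> p < e / 4 -> dK <= dK1 -> dK1 < e / 4 ->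
  q < dK -> A <= p + B -> B <= q + r -> r < dK -> A < e by lra.
pose d k : R := k.+1%:R^-1; have d0 k : 0 < d k by rewrite invr_gt0 ltr0n.
have dm i j : (i <= j)%N -> d j <= d i.
  by move=> ij; rewrite lef_pV2 ?posrE ?ltr0n // ler_nat.
have [a ha] := choice (fun k => Fc _ (d0 k)).
have [x hx] := choice (fun k => completion_in_approx (a k) (d0 k)).
have aa i j : mdist (a i) (a j) < d i + d j.
  have [c [ci cj]] := filter_ex (filterI (ha i) (ha j)).
  move: ci cj; rewrite !ballEmdist /= => ci; rewrite metric_sym => cj.
  exact: le_lt_trans (metric_triangle _ c _) (ltrD ci cj).
have xx i j : mdist (x i) (x j) < 2 * d i + 2 * d j.
  rewrite -completion_in_isometry.
  have h1 := metric_triangle (completion_in (x i)) (a i) (completion_in (x j)).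
  have h2 := metric_triangle (a i) (a j) (completion_in (x j)).
  have h3 := hx i; have h4 := hx j; have h5 := aa i j.
  rewrite metric_sym in h3; lra.
have small (e : R) : 0 < e -> exists K, d K < e.
  move=> e0; exists (Num.truncn e^-1); rewrite /d invf_plt ?posrE ?ltr0n //.
  exact: truncnS_gt.
have xc : cauchy (x @ \oo).
  apply/cauchy_ballP => e e0; have e4 : 0 < e / 4 by lra.
  have [K hK] := small _ e4.
  exists ([set y | exists2 i, (K <= i)%N & y = x i],
          [set y | exists2 i, (K <= i)%N & y = x i]).
    by split; exists K => // i /= Ki; exists i.
  move=> [y z] /= [[i Ki ->] [j Kj ->]].
  rewrite ballEmdist /=; have := xx i j; have := dm _ _ Ki; have := dm _ _ Kj.
  lra.
exists (\pi_completion (CauchySeq xc)).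
apply/cvg_ballP => e e0; have e4 : 0 < e / 4 by lra.
have [K1 hK1] := small _ e4.
have /cvg_ballP/(_ _ e4) [K2 _ hK2] := cvg_completion_in (u := CauchySeq xc).
pose K := maxn K1 K2; apply: filterS (ha K) => b.
rewrite !ballEmdist /= => aKb.
have := hK2 K (leq_maxr _ _); rewrite /= ballEmdist /= => h1.
have h2 := dm _ _ (leq_maxl K1 K2 : (K1 <= K)%N).
have h3 := hx K; rewrite metric_sym in h3.
have h4 := metric_triangle (\pi_completion (CauchySeq xc)) (completion_in (x K)) b.
have h5 := metric_triangle (completion_in (x K)) (a K) b.
exact: arith e4 h1 h2 hK1 h3 h4 h5 aKb.
Qed.

End Completion.

(* [slit_carpet R n] is the space written M_n in blackboard bold; [carpet n] is
   the plane set M_n it completes. *)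
Definition slit_carpet (R : realType) (n : nat) : metricType R :=
  completion (carpet_space R n).

Section Distortion.
Context (R : realType).

Definition bilipschitz (X Y : metricType R) (a b : R) (f : X -> Y) : Prop :=
  forall x y : X, a * mdist x y <= mdist (f x) (f y) <= b * mdist x y.

(* The infimum is [+oo] if there is no bi-Lipschitz embedding at all. *)
Definition euclidean_distortion (X : metricType R) : \bar R :=
  ereal_inf [set C%:E | C in [set C : R | 1 <= C /\
    exists (N : nat) (f : X -> euclidean R N), bilipschitz 1 C f]].

End Distortion.

(* Main.v *)
(* Lower bound.  A map with bounds (1, C) stretches the vertical median of a
   dyadic square of side 2^-m by some factor v <= C.  The median is shifted
   slightly to the left and to the right of the slit of the square: its end points
   hardly move, whereas the two copies of its midpoint are about 2^-m / 4 apart in the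
   path metric, or more.  So one of the copies is far from the midpoint of its end points,
   and by the parallelogram law one of its halves is stretched by v' with
   v'^2 >= v^2 + 1/25.  The shift costs about C^2 2^-J in v^2 when its size is
   2^(-m-J), which is harmless once 2^J >= 512 C^2, and the shifted segment can
   then be cut into medians of dyadic squares of level m + J.  With
   J = O(log n) this can be iterated about n / log n times, so that
   C^2 >= c n / log n.

   Upper bound.  Every slit carries a Lipschitz tent function with opposite signs
   on both sides of the slit, supported inside its dyadic square.  The map formed
   by the two coordinates and by all tents is O(sqrt n)-Lipschitz because each
   point is in the support of at most one tent of each level.  It is bi-Lipschitz
   because two points at Euclidean distance D can be joined by a path of length
   O(D) plus the detour around at most one slit, whose length the tent of that
   slit detects. *)

Require Import Defs.
From mathcomp Require Import all_boot all_order all_algebra.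
From mathcomp Require Import all_classical all_reals all_analysis.
From mathcomp Require Import zify ring lra.

Set Implicit Arguments.
Unset Strict Implicit.
Unset Printing Implicit Defensive.

Import Order.TTheory GRing.Theory Num.Theory.
Import numFieldNormedType.Exports.

Local Open Scope classical_set_scope.
Local Open Scope ring_scope.

(** * Points, segments and curves in the Euclidean plane *)

Section Plane.
Context (R : realType).
Implicit Types (p q r : euclidean R 2) (a b c d x y : R).

Definition pt x y : euclidean R 2 := \row_j (if j == 0 then x else y).

Lemma pt0 x y : pt x y 0 0 = x. Proof. by rewrite mxE. Qed.

Lemma pt1 x y : pt x y 0 1 = y. Proof. by rewrite mxE. Qed.

Lemma pt_eta p : p = pt (p 0 0) (p 0 1).
Proof.
apply/rowP => i; rewrite mxE; case: eqP => [->//|/eqP].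
by case: i => [[|[|]]] //= h _; congr (p _ _); apply: val_inj.
Qed.

Lemma euclideanE N (u v : euclidean R N) :
  mdist u v = Num.sqrt (\sum_(i < N) (u 0 i - v 0 i) ^+ 2).
Proof. by []. Qed.

Lemma sqr_mdist N (u v : euclidean R N) :
  mdist u v ^+ 2 = \sum_(i < N) (u 0 i - v 0 i) ^+ 2.
Proof. by rewrite euclideanE sqr_sqrtr // sumr_ge0 // => i _; exact: sqr_ge0. Qed.

Lemma coord_le_mdist N (u v : euclidean R N) i : `|u 0 i - v 0 i| <= mdist u v.
Proof.
rewrite -sqrtr_sqr euclideanE ler_wsqrtr // (bigD1 i) //= lerDl sumr_ge0 //.
by move=> j _; exact: sqr_ge0.
Qed.

Lemma mdist_plane p q :
  mdist p q = Num.sqrt ((p 0 0 - q 0 0) ^+ 2 + (p 0 1 - q 0 1) ^+ 2).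
Proof.
by rewrite euclideanE !big_ord_recl big_ord0 addr0; do 3 f_equal;
  congr (p _ _ - q _ _); apply: val_inj.
Qed.

Lemma mdist_horizontal x x' y : mdist (pt x y) (pt x' y) = `|x - x'|.
Proof. by rewrite mdist_plane !pt0 !pt1 subrr expr0n addr0 sqrtr_sqr. Qed.

Lemma mdist_vertical x y y' : mdist (pt x y) (pt x y') = `|y - y'|.
Proof. by rewrite mdist_plane !pt0 !pt1 subrr expr0n add0r sqrtr_sqr. Qed.

Lemma path_edist_segment (A : set (euclidean R 2)) p q :
  (forall t, t \in `[0, 1] -> A ((1 - t) *: p + t *: q)) ->
  (path_edist A p q <= (mdist p q)%:E)%E.
Proof.
pose s t : euclidean R 2 := (1 - t) *: p + t *: q => As.
have [|cs ls] := @lipschitz_curve_length _ _ s (mdist p q) (mdist_ge0 _ _).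
  move=> t u _ _; rewrite !euclideanE -sqrtr_sqr -sqrtrM; last first.
    by apply: sumr_ge0 => i _; exact: sqr_ge0.
  rewrite mulr_suml ler_wsqrtr // le_eqVlt; apply/orP; left; apply/eqP.
  by apply: eq_bigr => i _; rewrite !mxE; ring.
apply: le_trans ls; apply: ereal_inf_lbound; exists s => //; split=> //.
- by rewrite /s subr0 scale1r scale0r addr0.
- by rewrite /s subrr scale1r scale0r add0r.
Qed.

(** By the intermediate value theorem the abscissa takes the value [c] along [g]; the crossing point
    and the two ends form an inscribed polygonal line. *)
Lemma curve_crossing (A : set (euclidean R 2)) p q c g :
  p 0 0 <= c <= q 0 0 -> path_in A p q g ->
  exists2 r, A r /\ r 0 0 = c &
    ((mdist p r + mdist r q)%:E <= curve_length g)%E.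
Proof.
move=> pcq [gc gA g0 g1].
have xc : {within `[0, 1], continuous (fun t => g t 0 0)}.
  apply/subspace_continuousP => s s01; apply/cvg_ballP => e e0.
  move/within_unit_continuousP : gc => /(_ s e s01 e0) [d d0 hd].
  rewrite near_withinE; exists d => // t /= st t01.
  by apply: le_lt_trans (coord_le_mdist _ _ _) (hd t t01 st).
have [|t t01 tc] := IVT ler01 xc (v := c).
  by rewrite g0 g1; case/andP: pcq => h1 h2; rewrite ge_min h1 le_max h2 orbT.
exists (g t); first by split=> //; exact: gA.
move: (t01); rewrite in_itv /= => /andP[t0 t1].
pose u (i : nat) : R := if i is i'.+1 then (if i' is 0%N then t else 1) else 0.
have -> : mdist p (g t) + mdist (g t) q =
    \sum_(i < 2) mdist (g (u i)) (g (u i.+1)).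
  by rewrite !big_ord_recl big_ord0 /= g0 g1 addr0.
apply: curve_length_lb.
- by move=> [|[|i]] [|[|j]] //=; rewrite ?ler01 ?lexx.
- by move=> [|[|i]] /=; rewrite in_itv /= ?lexx ?ler01 ?t0.
Qed.

End Plane.

(** * The path metric of the carpet along horizontal and vertical segments *)

Section CarpetDistance.
Context (R : realType) (n : nat).
Implicit Types (p q r : euclidean R 2) (x y : R).

Notation cd := (path_dist (@carpet R n)).

Lemma le_path_dist p q e : carpet n p -> carpet n q ->
  (e%:E <= path_edist (@carpet R n) p q)%E -> e <= cd p q.
Proof. by move=> cp cq; rewrite -lee_fin fineK //; exact: carpet_edist_fin. Qed.

Lemma path_dist_le p q e : carpet n p -> carpet n q ->
  (path_edist (@carpet R n) p q <= e%:E)%E -> cd p q <= e.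
Proof. by move=> cp cq h; rewrite -lee_fin fineK //; exact: carpet_edist_fin. Qed.

Lemma mdist_le_path_dist p q : carpet n p -> carpet n q -> mdist p q <= cd p q.
Proof. by move=> cp cq; apply: le_path_dist => //; exact: path_edist_ge_dist. Qed.

Lemma path_dist_ge0 p q : carpet n p -> carpet n q -> 0 <= cd p q.
Proof. by move=> cp cq; apply: le_trans (mdist_le_path_dist cp cq); exact: mdist_ge0. Qed.

Lemma path_dist_sym p q : cd p q = cd q p.
Proof. by rewrite /path_dist path_edist_sym. Qed.

Lemma path_dist_triangle q p r : carpet n p -> carpet n q -> carpet n r ->
  cd p r <= cd p q + cd q r.
Proof.
move=> cp cq cr; apply: path_dist_le => //.
by rewrite EFinD !fineK; [exact: path_edist_triangle| exact: carpet_edist_fin..].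
Qed.

Lemma path_dist_segment p q :
  (forall t, t \in `[0, 1] -> carpet n ((1 - t) *: p + t *: q)) ->
  cd p q <= mdist p q.
Proof.
move=> h; apply: path_dist_le; last exact: path_edist_segment.
- by have := h 0; rewrite subr0 scale1r scale0r addr0; apply; rewrite in_itv /= lexx ler01.
- by have := h 1; rewrite subrr scale1r scale0r add0r; apply; rewrite in_itv /= lexx ler01.
Qed.

Lemma path_dist_horizontal x x' y : x <= x' ->
  (forall u : R, x <= u <= x' -> carpet n (pt u y)) ->
  cd (pt x y) (pt x' y) <= x' - x.
Proof.
move=> xx' h; have -> : x' - x = mdist (pt x y) (pt x' y).
  by rewrite mdist_horizontal distrC ger0_norm // subr_ge0.
apply: path_dist_segment => t; rewrite in_itv /= => /andP[t0 t1].
have -> : (1 - t) *: pt x y + t *: pt x' y = pt ((1 - t) * x + t * x') y.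
  by apply/rowP => i; rewrite !mxE; case: eqP => _ //; ring.
by apply: h; nra.
Qed.

(* Abscissas off the grid that carries all slits of level at most [n]. *)
Definition off_grid x : Prop := forall z : nat, x * 2 ^+ n.+1 <> z%:R.

(** For [m <= n] the slit abscissa, an odd multiple of [2^-(m+1)], is a multiple of [2^-(n+1)]. *)
Lemma slit_on_grid x y m l k : (m <= n)%N -> off_grid x -> ~ slit m l k (pt x y).
Proof.
move=> mn ox [+ _]; rewrite pt0 => xE.
apply: (ox ((2 * l + 1) * 2 ^ (n - m))%N).
have -> : n.+1 = (m.+1 + (n - m))%N by rewrite addSn subnKC.
by rewrite xE exprD mulrA divfK ?expf_neq0 // natrM natrX.
Qed.

Lemma off_grid_carpet x y : off_grid x -> 0 <= x <= 1 -> 0 <= y <= 1 ->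
  carpet n (pt x y).
Proof.
move=> ox x01 y01; apply/carpetP; split; first by rewrite /unit_square /= pt0 pt1.
by move=> m l k /andP[_ mn] _ _; exact: slit_on_grid.
Qed.

Lemma path_dist_vertical x y y' : off_grid x ->
  0 <= x <= 1 -> 0 <= y <= 1 -> 0 <= y' <= 1 ->
  cd (pt x y) (pt x y') <= `|y - y'|.
Proof.
move=> ox x01 y01 y01'; rewrite -(mdist_vertical x).
apply: path_dist_segment => t; rewrite in_itv /= => /andP[t0 t1].
have -> : (1 - t) *: pt x y + t *: pt x y' = pt x ((1 - t) * y + t * y').
  by apply/rowP => i; rewrite !mxE; case: eqP => _ //; ring.
by apply: off_grid_carpet => //; nra.
Qed.

End CarpetDistance.

(** * Arithmetic of dyadic coordinates *)

Section Dyadic.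
Context (R : realType).

Lemma dyadic_le a b i j :
  (a%:R / 2 ^+ i <= b%:R / 2 ^+ j :> R) = (a * 2 ^ j <= b * 2 ^ i)%N.
Proof.
rewrite ler_pdivrMr ?exprn_gt0 // mulrAC ler_pdivlMr ?exprn_gt0 //.
by rewrite -!natrX -!natrM ler_nat.
Qed.

Lemma dyadic_eq a b i j :
  (a%:R / 2 ^+ i == b%:R / 2 ^+ j :> R) = (a * 2 ^ j == b * 2 ^ i)%N.
Proof. by rewrite eq_le !dyadic_le eqn_leq. Qed.

(* The boundary lines of the dyadic squares of side [2^-M] avoid the slits of
   level at least [M]. *)
Lemma slit_row_level (r : R) (b M m l k : nat) :
  slit m l k (pt r (b%:R / 2 ^+ M)) -> (m < M)%N.
Proof.
case=> _; rewrite pt1 !dyadic_le => /andP[h1 h2].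
rewrite ltnNge; apply/negP => Mm.
have E : (2 ^ m.+2 = 2 ^ M * 2 ^ (m - M) * 4)%N.
  by rewrite -expnD subnKC // !expnS; lia.
move: h1 h2; rewrite E; have := expn_gt0 2 M.
move: (2 ^ M)%N (2 ^ (m - M))%N => P Q /= P0 h1 h2.
have h3 : (4 * k + 1 <= b * (Q * 4))%N by rewrite -(leq_pmul2r P0); lia.
have h4 : (b * (Q * 4) <= 4 * k + 3)%N by rewrite -(leq_pmul2r P0); lia.
lia.
Qed.

(** Both fractions are in lowest terms, their numerators being odd. *)
Lemma slit_abscissa_inj m l m' l' :
  (2 * l + 1)%:R / 2 ^+ m.+1 = (2 * l' + 1)%:R / 2 ^+ m'.+1 :> R ->
  m = m' /\ l = l'.
Proof.
move/eqP; rewrite dyadic_eq => /eqP.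
wlog mm : m l m' l' / (m <= m')%N.
  move=> W e; case: (leqP m m') => mm; first exact: W.
  by case: (W _ _ _ _ (ltnW mm) (esym e)) => -> ->.
rewrite -(subnKC mm) -addSn expnD mulnCA mulnC.
move/eqP; rewrite eqn_pmul2r ?expn_gt0 // => /eqP.
case: (m' - m)%N => [|d].
  by rewrite expn0 muln1 addn0 => h; split=> //; lia.
by rewrite expnS; lia.
Qed.

End Dyadic.

(** * The signed tent function of a slit *)

Section Bump.
Context (R : realType).
Implicit Types (p q r : euclidean R 2).

(** [slit_x] and [slit_y] are the coordinates of the centre of the slit, which is also the centre of
    its dyadic square. *)
Definition slit_x (m l : nat) : R := (2 * l + 1)%:R / 2 ^+ m.+1.
Definition slit_y (m k : nat) : R := (2 * k + 1)%:R / 2 ^+ m.+1.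

Lemma slit_yE m k : slit_y m k = (4 * k + 2)%:R / 2 ^+ m.+2.
Proof. by apply/eqP; rewrite /slit_y dyadic_eq [(2 ^ m.+2)%N]expnS; lia. Qed.

Definition hat (m l k : nat) p : R :=
  Num.max 0 ((2 ^+ m.+2)^-1 - `|p 0 1 - slit_y m k| - `|p 0 0 - slit_x m l|).

(* A tent function on a diamond having the slit as its vertical diagonal, with
   opposite signs on both sides of the slit. *)
Definition slit_bump (m l k : nat) p : R :=
  if p 0 0 < slit_x m l then - hat m l k p else hat m l k p.

Lemma hat_ge0 m l k p : 0 <= hat m l k p.
Proof. by rewrite le_max lexx. Qed.

Lemma hat_lip m l k p q : `|hat m l k p - hat m l k q| <= 2 * mdist p q.
Proof.
have arith (c a b a' b' e : R) : `|a - a'| <= e -> `|b - b'| <= e ->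
    `|Num.max 0 (c - a - b) - Num.max 0 (c - a' - b')| <= 2 * e.
  rewrite !ler_norml => /andP[h1 h2] /andP[h3 h4].
  by have [u|u] := leP 0 (c - a - b); have [v|v] := leP 0 (c - a' - b');
    apply/andP; split; lra.
apply: arith; apply: le_trans (ler_dist_dist _ _) _.
- by apply: le_trans (coord_le_mdist _ _ 1); rewrite opprB addrA subrK.
- by apply: le_trans (coord_le_mdist _ _ 0); rewrite opprB addrA subrK.
Qed.

(** A path in the carpet can cross the line of the slit only at such points, where the sign change
    of [slit_bump] does no harm. *)
Lemma hat_off_slit m l k p :
  p 0 0 = slit_x m l -> ~ slit m l k p -> hat m l k p = 0.
Proof.
move=> px ns; rewrite /hat max_l // leNgt; apply/negP => h; apply: ns; split=> //.
move: h; rewrite px subrr normr0 subr0 subr_gt0 => /ltW.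
rewrite ler_norml slit_yE.
rewrite ?natrD ?natrM ?mulrDl => /andP[h1 h2]; rewrite !div1r.
move: h1 h2; lra.
Qed.

(** On one side of the slit this is [hat_lip]. Between the two sides, every path meets the line of
    the slit at a carpet point [r] with zero hat, so the hats at [p] and [q] are bounded by the two
    pieces of the path separately. *)
Lemma slit_bump_lip n m l k p q : (0 < m <= n)%N -> (l < 2 ^ m)%N -> (k < 2 ^ m)%N ->
  carpet n p -> carpet n q ->
  `|slit_bump m l k p - slit_bump m l k q| <= 2 * path_dist (carpet n) p q.
Proof.
move=> mn lm km; wlog pq : p q / p 0 0 <= q 0 0.
  move=> W cp cq; have [/W|/ltW/W] := leP (p 0 0) (q 0 0); first exact.
  by rewrite distrC path_dist_sym; apply.
move=> cp cq.
have same : `|hat m l k p - hat m l k q| <= 2 * path_dist (carpet n) p q.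
  by apply: le_trans (hat_lip _ _ _ _ _) _; rewrite ler_pM2l //; exact: mdist_le_path_dist.
rewrite /slit_bump; have [xp|xp] := ltP (p 0 0) (slit_x m l);
  have [xq|xq] := ltP (q 0 0) (slit_x m l).
- by rewrite -opprD normrN.
- rewrite -opprD normrN -ler_pdivrMl //; apply: le_path_dist => //.
  apply: le_ereal_inf_tmp => _ [g pg <-].
  have [|r [cr rx] hr] := @curve_crossing _ _ p q (slit_x m l) g _ pg.
    by rewrite (ltW xp).
  apply: le_trans hr; rewrite lee_fin ler_pdivrMl // mulrDr.
  have r0 : hat m l k r = 0.
    by apply: hat_off_slit => //; case/carpetP: cr => _; exact.
  have := hat_lip m l k p r; have := hat_lip m l k r q.
  rewrite r0 subr0 sub0r normrN => h1 h2.
  by apply: le_trans (ler_normD _ _) _; lra.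
- by have := le_lt_trans (le_trans xp pq) xq; rewrite ltxx.
- exact: same.
Qed.

(** The diamond has radius [2^-m / 4], so it lies inside the open dyadic square; hence tents of one
    level have disjoint supports. *)
Lemma slit_bump_supp m l k p : slit_bump m l k p != 0 ->
  l%:R < p 0 0 * 2 ^+ m < l.+1%:R /\ k%:R < p 0 1 * 2 ^+ m < k.+1%:R.
Proof.
move=> b0.
have : 0 < hat m l k p.
  rewrite lt_def hat_ge0 andbT; apply: contra_neq b0; rewrite /slit_bump => ->.
  by rewrite oppr0 if_same.
rewrite lt_max ltxx /= /slit_x /slit_y.
have D0 : 0 < 2 ^+ m :> R by rewrite exprn_gt0.
set u := p 0 1 - _; set v := p 0 0 - _ => h.
have : `|u| < (2 ^+ m.+2)^-1 by have := normr_ge0 v; lra.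
have : `|v| < (2 ^+ m.+2)^-1 by have := normr_ge0 u; lra.
rewrite /u /v !ltr_norml; have -> : (2 ^+ m.+2)^-1 = (2 ^+ m)^-1 / 4 :> R.
  by rewrite !exprS !invfM; field; rewrite gt_eqF.
have E (z : nat) : (2 * z + 1)%:R / 2 ^+ m.+1 = (z%:R + 2^-1) / 2 ^+ m :> R.
  by rewrite natrD natrM exprS; field; rewrite gt_eqF.
rewrite !E -[l.+1%:R]natr1 -[k.+1%:R]natr1 => {h} /andP[h1 h2] /andP[h3 h4].
have V : (2 ^+ m)^-1 * 2 ^+ m = 1 :> R by rewrite mulVf // gt_eqF.
have V0 : 0 < (2 ^+ m)^-1 :> R by rewrite invr_gt0.
by split; apply/andP; split; rewrite -?(ltr_pdivrMr _ _ D0) -?(ltr_pdivlMr _ _ D0);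
  move: h1 h2 h3 h4 V0; lra.
Qed.

End Bump.

(** * Midpoints in Euclidean space and chains in metric spaces *)

Section EuclideanGeometry.
Context (R : realType) (N : nat).
Implicit Types (a e u v : euclidean R N).

Definition midpoint a e : euclidean R N := 2^-1 *: (a + e).

(** Apollonius' form of the parallelogram law, for the median from [u]. *)
Lemma parallelogram a e u :
  mdist a u ^+ 2 + mdist u e ^+ 2 =
  2 * mdist u (midpoint a e) ^+ 2 + mdist a e ^+ 2 / 2.
Proof.
rewrite !sqr_mdist mulr_sumr mulr_suml -!big_split /=.
by apply: eq_bigr => i _; rewrite !mxE; field.
Qed.

Lemma mdist_midpoint a e a' e' :
  mdist (midpoint a e) (midpoint a' e') <= (mdist a a' + mdist e e') / 2.
Proof.
have half (f : 'I_N -> R) :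
    Num.sqrt (\sum_(i < N) (f i / 2) ^+ 2) = Num.sqrt (\sum_(i < N) f i ^+ 2) / 2.
  rewrite -[X in _ = _ / X](ger0_norm (ler0n R 2)) -sqrtr_sqr.
  rewrite -sqrtrV ?sqr_ge0 // -sqrtrM ?sumr_ge0 // => [|i _]; last exact: sqr_ge0.
  by rewrite mulr_suml; congr Num.sqrt; apply: eq_bigr => i _; rewrite exprMn exprVn.
apply: le_trans (metric_triangle _ (midpoint a' e) _) _.
rewrite !euclideanE mulrDl -!half lerD // le_eqVlt; apply/orP; left; apply/eqP;
  by congr Num.sqrt; apply: eq_bigr => i _; rewrite !mxE; congr (_ ^+ 2); field.
Qed.

(** Pigeonhole on the triangle inequality: some step is at least the average. *)
Lemma chain_step (X : metricType R) (F : nat -> X) (K : nat) : (0 < K)%N ->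
  exists2 i, (i < K)%N & mdist (F 0%N) (F K) <= K%:R * mdist (F i) (F i.+1).
Proof.
move=> K0; apply: contrapT => h.
have lt (i : nat) : (i < K)%N -> mdist (F i) (F i.+1) < mdist (F 0%N) (F K) / K%:R.
  move=> iK; rewrite ltr_pdivlMr ?ltr0n // mulrC ltNge; apply/negP => hi.
  by apply: h; exists i.
have : mdist (F 0%N) (F K) < K%:R * (mdist (F 0%N) (F K) / K%:R).
  move: lt; move: (_ / _) => B; case: K K0 {h} => // K _ lt.
  elim: K lt => [|K IH] lt; first by rewrite mul1r lt.
  apply: le_lt_trans (metric_triangle _ (F K.+1) _) _.
  by rewrite -natr1 mulrDl mul1r ltrD ?lt // IH // => i iK; apply: lt; lia.
by rewrite mulrC divfK ?ltxx // pnatr_eq0 -lt0n.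
Qed.

End EuclideanGeometry.

(** * Horizontal dyadic lines inside the carpet *)

Section Rows.
Context (R : realType) (n : nat).
Implicit Types (x y r : R).

(** Only slits of level below [M] have to be checked, since [slit_row_level] excludes the others. *)
Lemma carpet_row r (b M : nat) : 0 <= r <= 1 -> (b <= 2 ^ M)%N ->
  (forall m l k, (0 < m <= n)%N -> (l < 2 ^ m)%N -> (k < 2 ^ m)%N -> (m < M)%N ->
    ~ slit m l k (pt r (b%:R / 2 ^+ M))) ->
  carpet n (pt r (b%:R / 2 ^+ M)).
Proof.
move=> r01 bM h; apply/carpetP; split=> [|m l k mn lm km s].
  split; rewrite ?pt0 ?pt1 // divr_ge0 ?exprn_ge0 //=.
  by rewrite ler_pdivrMr ?exprn_gt0 // mul1r -natrX ler_nat.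
by apply: (h m l k) => //; exact: slit_row_level s.
Qed.

(* The slits of level below [m] lie on the vertical boundary lines of the
   dyadic squares of side [2^-m]. *)
Lemma carpet_row_in_square m l k r : (l < 2 ^ m)%N -> (k <= 2 ^ m)%N ->
  `|r - slit_x R m l| < (2 ^+ m.+1)^-1 -> carpet n (pt r (k%:R / 2 ^+ m)).
Proof.
move=> lm km hr; have D0 : 0 < 2 ^+ m.+1 :> R by rewrite exprn_gt0.
have /andP[rl ru] : (2 * l)%:R / 2 ^+ m.+1 < r < (2 * l.+1)%:R / 2 ^+ m.+1.
  move: hr; rewrite ltr_norml /slit_x mulnS addnC !natrD.
  by rewrite !mulrDl => /andP[]; rewrite !mul1r => h1 h2; apply/andP; split; lra.
apply: carpet_row => //.
- apply/andP; split.
    by apply: le_trans (ltW rl); rewrite divr_ge0 ?exprn_ge0.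
  apply: le_trans (ltW ru) _.
  by rewrite ler_pdivrMr // mul1r -natrX ler_nat expnS leq_pmul2l.
- move=> m' l' k' _ _ _ mm' [rE _]; move: rl ru; rewrite pt0 in rE; rewrite rE.
  rewrite !ltNge !dyadic_le -!ltnNge.
  have -> : (2 ^ m.+1 = 2 ^ m'.+1 * 2 ^ (m - m').-1 * 2)%N.
    by rewrite -expnD -expnSr; congr expn; lia.
  have := expn_gt0 2 m'.+1; move: (2 ^ m'.+1)%N (2 ^ (m - m').-1)%N => P Q /= P0.
  move=> h1 h2.
  have : (l < (2 * l' + 1) * Q)%N by rewrite -(ltn_pmul2r P0); lia.
  have : ((2 * l' + 1) * Q < l.+1)%N by rewrite -(ltn_pmul2r P0); lia.
  lia.
Qed.

Lemma path_dist_row_in_square m l k x x' : (l < 2 ^ m)%N -> (k <= 2 ^ m)%N ->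
  `|x - slit_x R m l| < (2 ^+ m.+1)^-1 -> `|x' - slit_x R m l| < (2 ^+ m.+1)^-1 ->
  path_dist (carpet n) (pt x (k%:R / 2 ^+ m)) (pt x' (k%:R / 2 ^+ m)) <= `|x - x'|.
Proof.
move=> lm km; wlog xx' : x x' / x <= x'.
  move=> W hx hx'; have [/W|/ltW/W] := leP x x'; first by apply.
  by move=> h; rewrite path_dist_sym distrC; exact: h.
rewrite !ltr_norml => /andP[h1 h2] /andP[h3 h4].
rewrite distrC ger0_norm ?subr_ge0 //; apply: path_dist_horizontal => // u /andP[u1 u2].
by apply: (carpet_row_in_square lm km); rewrite ltr_norml; apply/andP; split; lra.
Qed.

End Rows.

(** * Lower bound: one step of the stretch-factor increment *)

Section LowerBound.
Context (R : realType) (n N : nat) (G : euclidean R 2 -> euclidean R N) (C : R).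
Hypothesis C1 : 1 <= C.
Hypothesis Glb : forall p q, carpet n p -> carpet n q ->
  path_dist (carpet n) p q <= mdist (G p) (G q).
Hypothesis Gub : forall p q, carpet n p -> carpet n q ->
  mdist (G p) (G q) <= C * path_dist (carpet n) p q.

(* The vertical median of a dyadic square, shifted off the grid. *)
Let col m l : R := slit_x R m l + (2 ^+ n.+2)^-1.
Let row m k : R := k%:R / 2 ^+ m.

(** The stretch factor of [G] on the shifted median, whose length is [2^-m]. *)
Definition slope m l k : R :=
  2 ^+ m * mdist (G (pt (col m l) (row m k))) (G (pt (col m l) (row m k.+1))).

(** [slit_x m l] lies on the grid of mesh [2^-(n+1)] and the shift is half that mesh. *)
Let col_off m l : (m <= n)%N -> off_grid n (col m l).
Proof.
move=> mn z; rewrite /col /slit_x mulrDl.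
have -> : 2 ^+ n.+1 = 2 ^+ m.+1 * 2 ^+ (n - m) :> R by rewrite -exprD addSn subnKC.
rewrite mulrA divfK ?expf_neq0 //.
have -> : (2 ^+ n.+2)^-1 * (2 ^+ m.+1 * 2 ^+ (n - m)) = 2^-1 :> R.
  by rewrite -exprD addSn subnKC // [2 ^+ n.+2]exprS invfM mulfVK // expf_neq0.
move=> /(congr1 (fun u => u * 2)); rewrite mulrDl mulVf // -natrX -!natrM natr1.
move=> /eqP; rewrite eqr_nat => /eqP; lia.
Qed.

Let eps_le m : (m <= n)%N -> (2 ^+ n.+2)^-1 <= (2 ^+ m.+2)^-1 :> R.
Proof.
move=> mn; rewrite lef_pV2 ?posrE ?exprn_gt0 //.
by apply: ler_weXn2l; rewrite ?ler1n.
Qed.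

Let eps_gt0 m : 0 < (2 ^+ m)^-1 :> R.
Proof. by rewrite invr_gt0 exprn_gt0. Qed.

Let powS m : (2 ^+ m)^-1 = 2 * (2 ^+ m.+1)^-1 :> R.
Proof. by rewrite exprS; field; rewrite expf_neq0. Qed.

Let slit_x01 m l : (l < 2 ^ m)%N ->
  (2 ^+ m.+1)^-1 <= slit_x R m l <= 1 - (2 ^+ m.+1)^-1.
Proof.
move=> lm; rewrite /slit_x -[X in X <= _ <= _]mul1r -[in X in _ <= _ <= X](mul1r (_^-1)).
rewrite ler_pM2r // lerBrDr -mulrDl ler_pdivrMr ?exprn_gt0 // mul1r.
apply/andP; split; first by rewrite ler1n addn1.
by rewrite natr1 -natrX ler_nat expnS; lia.
Qed.

Let col01 m l : (m <= n)%N -> (l < 2 ^ m)%N -> 0 <= col m l <= 1.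
Proof.
move=> mn /slit_x01 /andP[h1 h2]; rewrite /col.
have := eps_le mn; have := powS m.+1; have := eps_gt0 m.+1; have := eps_gt0 n.+2.
by move=> ? ? ? ?; apply/andP; split; lra.
Qed.

Let row01 m k : (k <= 2 ^ m)%N -> 0 <= row m k <= 1.
Proof.
move=> km; rewrite /row divr_ge0 ?exprn_ge0 //=.
by rewrite ler_pdivrMr ?exprn_gt0 // mul1r -natrX ler_nat.
Qed.

Let on_col m l k i : (m <= n)%N -> (l < 2 ^ m)%N -> (k <= 2 ^ i)%N ->
  carpet n (pt (col m l) (row i k)).
Proof.
by move=> mn lm km; apply: off_grid_carpet; [exact: col_off|exact: col01|exact: row01].
Qed.

Lemma slope_le m l k : (m <= n)%N -> (l < 2 ^ m)%N -> (k < 2 ^ m)%N ->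
  slope m l k <= C.
Proof.
move=> mn lm km; rewrite /slope mulrC -ler_pdivlMr ?exprn_gt0 //.
apply: le_trans (Gub (on_col mn lm (ltnW km)) (on_col mn lm km)) _.
rewrite ler_pM2l; last exact: lt_le_trans C1.
apply: le_trans (path_dist_vertical (col_off mn) (col01 mn lm) (row01 (ltnW km)) (row01 km)) _.
rewrite /row -mulrBl normrM distrC -natrB // subSnn normr1 mul1r.
by rewrite ger0_norm ?invr_ge0 ?exprn_ge0.
Qed.

Lemma row_refine m j k : row m k = row (m + j) (k * 2 ^ j).
Proof. by apply/eqP; rewrite /row dyadic_eq expnD; lia. Qed.

(** The segment of height [2^-i] is cut into [2^j] medians of level [m]; by [chain_step] one of them
    is stretched at least as much as the whole. *)
Lemma slope_refine i j l k (m := (i + j)%N) :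
  (k < 2 ^ i)%N ->
  exists2 k', (k' < 2 ^ m)%N &
    2 ^+ i * mdist (G (pt (col m l) (row i k))) (G (pt (col m l) (row i k.+1)))
      <= slope m l k'.
Proof.
move=> ki; pose F a := G (pt (col m l) (row m (k * 2 ^ j + a))).
have [a aj hF] := chain_step F (K := 2 ^ j) (ltac:(by rewrite expn_gt0)).
exists (k * 2 ^ j + a)%N.
  apply: (@leq_trans (k.+1 * 2 ^ j)); first by rewrite mulSn addnC ltn_add2r.
  by rewrite /m expnD leq_pmul2r // expn_gt0.
rewrite /slope /m exprD -mulrA ler_pM2l ?exprn_gt0 // -natrX.
rewrite !(row_refine i j) mulSn [(2 ^ j + _)%N]addnC -addnS; apply: le_trans hF.
by rewrite /F addn0.
Qed.

(** [A] and [A'] are the image lengths of the median before and after the shift, [P] and [Q] those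
    of its halves, and [d] is the deviation of the image of the midpoint. The deviation adds
    [2 * (3/25)^2 * s^2] to [P^2 + Q^2], the shift loses at most [s^2 / 256], and the balance still
    exceeds [2 * s^2 / 100]. *)
Let half_gain (P Q d A A' s T : R) : 0 < s -> 0 <= A -> 0 <= A' ->
  256 * C ^+ 2 * T <= 1 -> 0 < T -> 3 / 25 * s <= d ->
  P ^+ 2 + Q ^+ 2 = 2 * d ^+ 2 + A' ^+ 2 / 2 ->
  A - C * s * T <= A' -> A <= C * s ->
  A ^+ 2 / 4 + s ^+ 2 / 100 <= P ^+ 2 \/ A ^+ 2 / 4 + s ^+ 2 / 100 <= Q ^+ 2.
Proof.
move=> s0 A0 A'0 CT T0 ds PQ AA' As.
have [|h1] := leP (A ^+ 2 / 4 + s ^+ 2 / 100) (P ^+ 2); first by left.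
have [|h2] := leP (A ^+ 2 / 4 + s ^+ 2 / 100) (Q ^+ 2); first by right.
have e1 : A ^+ 2 - 2 * A * (C * s * T) <= A' ^+ 2.
  move: AA'; set c := C * s * T => AA'.
  have [h|h] := leP c A.
    apply: (@le_trans _ _ ((A - c) ^+ 2)); first by have := sqr_ge0 c; lra.
    by rewrite lerXn2r // nnegrE subr_ge0.
  (* If the loss [c] exceeds [A], the left side is not positive. *)
  apply: le_trans (sqr_ge0 _); have -> : A ^+ 2 - 2 * A * c = A * (A - 2 * c) by ring.
  by rewrite mulr_ge0_le0 //; lra.
have e2 : A * (C * s * T) <= C ^+ 2 * T * s ^+ 2.
  have CsT : 0 <= C * s * T by rewrite !mulr_ge0 ?(ltW s0) ?(ltW T0) // (le_trans ler01).
  have -> : C ^+ 2 * T * s ^+ 2 = C * s * (C * s * T) by ring.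
  exact: ler_wpM2r.
have e3 : 256 * (C ^+ 2 * T * s ^+ 2) <= s ^+ 2.
  have -> : 256 * (C ^+ 2 * T * s ^+ 2) = 256 * C ^+ 2 * T * s ^+ 2 by ring.
  by rewrite -[leRHS]mul1r ler_wpM2r // sqr_ge0.
have e4 : (3 / 25) ^+ 2 * s ^+ 2 <= d ^+ 2.
  by rewrite -exprMn lerXn2r // nnegrE; lra.
have : 0 < s ^+ 2 by rewrite exprn_gt0.
lra.
Qed.

Lemma slope_step m j l k (m' := (m.+1 + j)%N) :
  (0 < m)%N -> (m' <= n)%N -> (l < 2 ^ m)%N -> (k < 2 ^ m)%N ->
  512 * C ^+ 2 <= 2 ^+ j.+1 ->
  exists l' k', [/\ (l' < 2 ^ m')%N, (k' < 2 ^ m')%N &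
    slope m l k ^+ 2 + 1 / 25 <= slope m' l' k' ^+ 2].
Proof.
move=> m0 m'n lm km CJ; have mn : (m <= n)%N by lia.
(* The slit abscissa equals [l1 / 2^m'], so the columns [l1.-1] and [l1] of level [m'] are adjacent
   to the slit on its left and right. *)
pose l1 := ((2 * l + 1) * 2 ^ j)%N.
have pj : (0 < 2 ^ j)%N by rewrite expn_gt0.
have l1m : (l1 < 2 ^ m')%N.
  by rewrite /l1 /m' expnD ltn_pmul2r // expnS; lia.
have k1 : ((2 * k).+1 < 2 ^ m.+1)%N by rewrite expnS; lia.
have k0 : (2 * k < 2 ^ m.+1)%N by apply: ltnW.
have l10 : (0 < l1)%N by rewrite muln_gt0 pj addn1.
(* [s] is the side of the given square and [s * T = 2^-m'] the side at the new level. *)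
pose s : R := (2 ^+ m)^-1; pose T : R := (2 ^+ j.+1)^-1.
have s0 : 0 < s := eps_gt0 m; have T0 : 0 < T := eps_gt0 j.+1.
have CT : 512 * C ^+ 2 * T <= 1 by rewrite ler_pdivrMr ?exprn_gt0 // mul1r.
have C0 : 0 < C by exact: lt_le_trans C1.
have CT1 : 512 * (C * T) <= 1.
  have : C * T <= C ^+ 2 * T by rewrite ler_pM2r // expr2 ler_peMl // ltW.
  by move: CT; rewrite -[512 * _ * T]mulrA; lra.
have TC : T <= C * T by rewrite ler_peMl // ltW.
pose e : R := (2 ^+ n.+2)^-1; have e0 : 0 < e := eps_gt0 n.+2.
have esT : 4 * e <= s * T.
  rewrite /s /T -invfM -exprD addnS.
  have := eps_le m'n; rewrite -/e /m' addSn.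
  by have := powS (m + j).+1; have := powS (m + j).+2; lra.
have sxr : slit_x R m' l1 = slit_x R m l + s * T / 2.
  rewrite /slit_x /s /T /l1 /m' !(natrD, natrM) natrX addSn !exprS exprD.
  by field; rewrite !expf_neq0.
have sxl : slit_x R m' l1.-1 = slit_x R m l - s * T / 2.
  have : slit_x R m' l1 = slit_x R m' l1.-1 + s * T.
    rewrite /slit_x /s /T -{1}(prednK l10) mulnS -addnA addnC natrD mulrDl addnC.
    congr (_ + _); rewrite /m' addSn !exprS exprD.
    by field; rewrite !expf_neq0.
  by rewrite sxr; lra.
(* The off-grid shift [e] is common to both columns and cancels in their difference. *)
have near_l (l' : nat) : slit_x R m' l' = slit_x R m l + s * T / 2 \/
    slit_x R m' l' = slit_x R m l - s * T / 2 ->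
    `|col m' l' - slit_x R m l| < (2 ^+ m.+1)^-1 /\ `|col m l - col m' l'| <= s * T / 2.
  have := powS m; rewrite -/s => sE.
  have T4 : T <= 1 / 512 by lra.
  have sT : s * T <= s * (1 / 512) by rewrite ler_pM2l.
  have sT0 : 0 < s * T by rewrite mulr_gt0.
  rewrite /col -/e; clear CJ CT CT1 TC sxr sxl T4.
  by case=> ->; rewrite ltr_norml ler_norml; split; apply/andP; split; lra.
have near0 : `|col m l - slit_x R m l| < (2 ^+ m.+1)^-1.
  have := eps_le mn; have := powS m.+1; rewrite -/e /col => h1 h2.
  by rewrite addrAC subrr add0r gtr0_norm // -/e; have := eps_gt0 m.+2; lra.
pose A := mdist (G (pt (col m l) (row m k))) (G (pt (col m l) (row m k.+1))).
have slopeE : slope m l k = A / s by rewrite /slope /s invrK mulrC.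
have As : A <= C * s by rewrite -ler_pdivrMr // -slopeE slope_le.
have A0 : 0 <= A := mdist_ge0 _ _.
have rowE : row m k = row m.+1 (2 * k) by rewrite (row_refine m 1) addn1 mulnC.
have rowE' : row m k.+1 = row m.+1 (2 * k).+2.
  by rewrite (row_refine m 1) addn1 expn1 muln2 mul2n doubleS.
have shift (l' b : nat) : (l' < 2 ^ m')%N -> (b <= 2 ^ m)%N ->
    `|col m' l' - slit_x R m l| < (2 ^+ m.+1)^-1 -> `|col m l - col m' l'| <= s * T / 2 ->
    mdist (G (pt (col m l) (row m b))) (G (pt (col m' l') (row m b))) <= C * (s * T / 2).
  move=> l'm bm h1 h2; apply: le_trans (Gub (on_col mn lm bm) (on_col m'n l'm bm)) _.
  by rewrite ler_pM2l //; apply: le_trans h2; exact: (path_dist_row_in_square n lm bm).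
pose a l' := G (pt (col m' l') (row m k)); pose z l' := G (pt (col m' l') (row m k.+1)).
pose u l' := G (pt (col m' l') (row m.+1 (2 * k).+1)).
have gain (l' : nat) : (l' < 2 ^ m')%N -> `|col m' l' - slit_x R m l| < (2 ^+ m.+1)^-1 ->
    `|col m l - col m' l'| <= s * T / 2 ->
    3 / 25 * s <= mdist (u l') (midpoint (a l') (z l')) ->
    exists l' k', [/\ (l' < 2 ^ m')%N, (k' < 2 ^ m')%N &
      slope m l k ^+ 2 + 1 / 25 <= slope m' l' k' ^+ 2].
  move=> l'm h1 h2 h3.
  have CT' : 256 * C ^+ 2 * T <= 1.
    by apply: le_trans CT; rewrite ler_pM2r // ler_pM2r ?exprn_gt0 // ler_nat.
  have AA' : A - C * s * T <= mdist (a l') (z l').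
    have := metric_triangle (G (pt (col m l) (row m k))) (a l') (G (pt (col m l) (row m k.+1))).
    have := metric_triangle (a l') (z l') (G (pt (col m l) (row m k.+1))).
    have := shift _ _ l'm (ltnW km) h1 h2; have := shift _ _ l'm km h1 h2.
    rewrite -/(a l') -/(z l') -/A [mdist (z l') _]metric_sym; lra.
  have fin (b : nat) (B : R) : (b < 2 ^ m.+1)%N ->
      B = mdist (G (pt (col m' l') (row m.+1 b))) (G (pt (col m' l') (row m.+1 b.+1))) ->
      A ^+ 2 / 4 + s ^+ 2 / 100 <= B ^+ 2 ->
      exists l' k', [/\ (l' < 2 ^ m')%N, (k' < 2 ^ m')%N &
        slope m l k ^+ 2 + 1 / 25 <= slope m' l' k' ^+ 2].
    move=> bm BE hB; have [k' k'm hk'] := slope_refine j l' bm.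
    exists l', k'; split=> //; rewrite -BE in hk'.
    have B0 : 0 <= B by rewrite BE mdist_ge0.
    have : (2 ^+ m.+1 * B) ^+ 2 <= slope m' l' k' ^+ 2.
      by rewrite lerXn2r ?nnegrE ?mulr_ge0 ?exprn_ge0 ?mdist_ge0.
    apply: le_trans; rewrite slopeE.
    have -> : 2 ^+ m.+1 = 2 / s :> R by rewrite /s invrK exprS.
    (* Each half has length [s / 2], so the gain [s^2 / 100] becomes [4 / 100] in the squared
       stretch factor. *)
    have -> : (A / s) ^+ 2 + 1 / 25 = (A ^+ 2 / 4 + s ^+ 2 / 100) * (2 / s) ^+ 2.
      by field; rewrite gt_eqF.
    by rewrite [leRHS]exprMn mulrC ler_wpM2l ?sqr_ge0.
  have [] := half_gain s0 A0 (mdist_ge0 _ _) CT' T0 h3 (parallelogram _ _ _) AA' As.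
  - by move=> hB; apply: (fin _ _ k0 _ hB); rewrite /a /u rowE.
  - by move=> hB; apply: (fin _ _ k1 _ hB); rewrite /z /u rowE'.
have l1m' : (l1.-1 < 2 ^ m')%N := leq_ltn_trans (leq_pred _) l1m.
have [r1 r2] := near_l l1 (or_introl sxr); have [r3 r4] := near_l l1.-1 (or_intror sxl).
clear CJ.
(* The two copies of the midpoint are separated by the slit. Its bump differs between them by
   [s / 2 - s * T] and is 2-Lipschitz. *)
have du : s / 4 - s * T / 2 <= mdist (u l1) (u l1.-1).
  have ym := ltnW k1.
  apply: le_trans (Glb (on_col m'n l1m ym) (on_col m'n l1m' ym)).
  have mn0 : (0 < m <= n)%N by rewrite m0.
  have := slit_bump_lip mn0 lm km (on_col m'n l1m ym) (on_col m'n l1m' ym).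
  rewrite /slit_bump !pt0.
  have sT0 : 0 < s * T by rewrite mulr_gt0.
  have -> : (col m' l1 < slit_x R m l) = false.
    by apply/negbTE; rewrite -leNgt /col sxr -/e; lra.
  have -> : col m' l1.-1 < slit_x R m l by rewrite /col sxl -/e; lra.
  have hatE (l' : nat) : (2 ^+ m.+2)^-1 - `|col m' l' - slit_x R m l| <=
      hat m l k (pt (col m' l') (row m.+1 (2 * k).+1)).
    by rewrite /hat pt0 pt1 /slit_y addn1 -/(row m.+1 _) subrr normr0 subr0 le_max lexx orbT.
  have := hatE l1; have := hatE l1.-1.
  have -> : col m' l1.-1 - slit_x R m l = - (s * T / 2 - e) by rewrite /col sxl -/e; ring.
  have -> : col m' l1 - slit_x R m l = s * T / 2 + e by rewrite /col sxr -/e; ring.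
  have nn1 : 0 <= s * T / 2 - e by lra.
  have nn2 : 0 <= s * T / 2 + e by lra.
  rewrite normrN (ger0_norm nn1) (ger0_norm nn2) opprK.
  have := powS m; have := powS m.+1; rewrite -/s.
  move=> h1 h2 h3 h4; have := ler_norm (hat m l k (pt (col m' l1) (row m.+1 (2 * k).+1)) +
     hat m l k (pt (col m' l1.-1) (row m.+1 (2 * k).+1))).
  lra.
have dc : mdist (midpoint (a l1) (z l1)) (midpoint (a l1.-1) (z l1.-1)) <= C * (s * T).
  apply: le_trans (mdist_midpoint _ _ _ _) _.
  have := metric_triangle (a l1) (G (pt (col m l) (row m k))) (a l1.-1).
  have := metric_triangle (z l1) (G (pt (col m l) (row m k.+1))) (z l1.-1).
  have := shift _ _ l1m (ltnW km) r1 r2; have := shift _ _ l1m km r1 r2.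
  have := shift _ _ l1m' (ltnW km) r3 r4; have := shift _ _ l1m' km r3 r4.
  rewrite -/(a l1) -/(z l1) -/(a l1.-1) -/(z l1.-1).
  rewrite [mdist _ (a l1)]metric_sym [mdist _ (z l1)]metric_sym; lra.
have [d1|d1] := leP (3 / 25 * s) (mdist (u l1) (midpoint (a l1) (z l1))).
  exact: gain d1.
(* If both deviations were below [3/25 * s], the images of the two copies would be less than
   [6/25 * s + C * (s * T)] apart, contradicting [du] because [C * T <= 1/512]. *)
apply: (gain l1.-1) => //; rewrite leNgt; apply/negP => d2.
have := metric_triangle (u l1) (midpoint (a l1) (z l1)) (u l1.-1).
have := metric_triangle (midpoint (a l1) (z l1)) (midpoint (a l1.-1) (z l1.-1)) (u l1.-1).
rewrite [mdist (midpoint (a l1.-1) _) _]metric_sym.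
have h1 : s * T <= s / 512 by rewrite ler_pM2l // -[_^-1]mul1r; lra.
have h2 : C * (s * T) <= s / 512.
  by rewrite mulrCA ler_pM2l // -[_^-1]mul1r; lra.
move: d1 d2 du dc; lra.
Qed.

End LowerBound.

(** * Lower bound: iteration over the levels *)

Section LowerBoundIteration.
Context (R : realType) (n N : nat) (G : euclidean R 2 -> euclidean R N) (C : R).
Hypothesis C1 : 1 <= C.
Hypothesis Glb : forall p q, carpet n p -> carpet n q ->
  path_dist (carpet n) p q <= mdist (G p) (G q).
Hypothesis Gub : forall p q, carpet n p -> carpet n q ->
  mdist (G p) (G q) <= C * path_dist (carpet n) p q.

(** Starting from level 1, the first level with slits, each [slope_step] costs [j.+1] levels and
    gains [1/25]. *)
Lemma slope_iter j i : 512 * C ^+ 2 <= 2 ^+ j.+1 -> (i * j.+1 < n)%N ->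
  exists l k, [/\ (l < 2 ^ (i * j.+1).+1)%N, (k < 2 ^ (i * j.+1).+1)%N &
    i%:R / 25 <= slope n G (i * j.+1).+1 l k ^+ 2].
Proof.
move=> CJ; elim: i => [|i IH] ij; first by exists 0%N, 0%N; rewrite mul0r sqr_ge0.
have [|l [k [lm km h]]] := IH; first by apply: leq_ltn_trans ij; rewrite leq_mul2r leqnSn orbT.
have E : ((i * j.+1).+2 + j = (i.+1 * j.+1).+1)%N by rewrite mulSn; lia.
have En : ((i * j.+1).+2 + j <= n)%N by rewrite E.
have [l' [k' []]] := slope_step C1 Glb Gub (isT : (0 < (i * j.+1).+1)%N) En lm km CJ.
rewrite E => l'm k'm h'; exists l', k'; split=> //.
by apply: le_trans h'; rewrite -natr1 mulrDl; lra.
Qed.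

Lemma distortion_ge : (3 <= n)%N -> n%:R / ln n%:R <= 576 * C ^+ 2.
Proof.
move=> n3; have n0 : 0 < n%:R :> R by rewrite ltr0n; lia.
(* From [ln (1 + x) <= x] at [x = -1/2]. *)
have ln2 : 1 / 2 <= ln 2 :> R.
  have h : -1 < - (1 / 2) :> R by lra.
  have := le_ln1Dx h; have -> : 1 + - (1 / 2) = 2^-1 :> R by lra.
  by rewrite lnV ?posrE //; lra.
pose t := trunc_log 2 n.
have t1 : (1 <= t)%N by rewrite trunc_log_gt0 // (leq_trans _ n3).
have lnn : t%:R <= 2 * ln n%:R :> R.
  have : t%:R * ln 2 <= ln n%:R :> R.
    rewrite mulr_natl -lnXn // ler_ln ?posrE ?exprn_gt0 // -natrX ler_nat.
    by apply: trunc_logP => //; lia.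
  have : 0 <= t%:R :> R by [].
  nra.
have t1R : 1 <= t%:R :> R by rewrite ler1n.
have ln0 : 0 < ln n%:R :> R by lra.
rewrite ler_pdivrMr //.
have [Cn|Cn] := leP n%:R (C ^+ 2).
  have h : C ^+ 2 * (1 / 2) <= C ^+ 2 * ln n%:R by rewrite ler_wpM2l ?sqr_ge0 //; lra.
  by rewrite -mulrA; lra.
have [j [CJ JR]] : exists j : nat,
    512 * C ^+ 2 <= 2 ^+ j.+1 /\ j.+1%:R <= 22 * ln n%:R :> R.
  (* Here [512 = 2^9] and [C^2 < n < 2^(t+1)]; also [t + 10 <= 22 * ln n] because
     [1 <= t <= 2 * ln n]. *)
  exists (t + 9)%N; split; last by rewrite -natr1 natrD; lra.
  apply: (@le_trans _ _ (512 * n%:R)); first by lra.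
  rewrite -natrM -natrX ler_nat -addSn expnD.
  by have := @trunc_log_ltn 2 n isT; rewrite -/t; lia.
have n1 : (0 < n)%N by apply: leq_trans n3.
(* [q] is the largest number of steps that stays within level [n]. *)
have [q qn qn'] : exists2 q, (q * j.+1 < n)%N & (n <= q.+1 * j.+1)%N.
  exists (n.-1 %/ j.+1)%N; first by apply: leq_ltn_trans (leq_divM _ _) _; rewrite ltn_predL.
  by have := ltn_ceil n.-1 (ltn0Sn j); rewrite prednK.
have [l [k [lm km h]]] := slope_iter CJ qn.
have slC := slope_le C1 Gub qn lm km.
have C2q : q%:R / 25 <= C ^+ 2.
  have sl0 : 0 <= slope n G (q * j.+1).+1 l k by rewrite mulr_ge0 ?exprn_ge0 ?mdist_ge0.
  by apply: le_trans h _; rewrite lerXn2r // nnegrE (le_trans sl0).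
have nq : n%:R <= q.+1%:R * j.+1%:R :> R by rewrite -natrM ler_nat.
have C21 : 1 <= C ^+ 2 by rewrite exprn_ege1.
have qC : q.+1%:R <= 26 * C ^+ 2 by rewrite -natr1; lra.
(* The product [26 * 22 = 572] is rounded up to [576 = 24^2]. *)
apply: le_trans nq _; have -> : 576 * C ^+ 2 * ln n%:R =
   (26 * C ^+ 2) * (22 * ln n%:R) + 4 * C ^+ 2 * ln n%:R by ring.
apply: (@le_trans _ _ ((26 * C ^+ 2) * (22 * ln n%:R))); first exact: ler_pM.
by rewrite lerDl mulr_ge0 ?(ltW ln0) // mulr_ge0 // sqr_ge0.
Qed.

End LowerBoundIteration.

(** * Extension of bi-Lipschitz maps to the completion *)

Section CompletionExtension.
Context (R : realType) (X : metricType R) (N : nat) (F : X -> euclidean R N).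
Variable C : R.
Hypothesis C0 : 0 < C.
Hypothesis Flb : forall x y, mdist x y <= mdist (F x) (F y).
Hypothesis Fub : forall x y, mdist (F x) (F y) <= C * mdist x y.

(** Each coordinate of [F] along the representative Cauchy sequence is Cauchy by the Lipschitz
    bound; both inequalities pass to the limit. *)
Lemma bilipschitz_completion :
  exists f : completion X -> euclidean R N, bilipschitz 1 C f.
Proof.
pose f (a : completion X) : euclidean R N :=
  \row_i lim (F (repr a k) 0 i @[k --> \oo]).
have fc (a : completion X) i : F (repr a k) 0 i @[k --> \oo] --> f a 0 i.
  rewrite mxE; apply: cauchy_cvg; apply/cauchy_ballP => e e0.
  have [K hK] := cauchy_seq_mdist (repr a) (divr_gt0 e0 C0).
  exists ([set x | exists2 k, (K <= k)%N & x = F (repr a k) 0 i],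
          [set x | exists2 k, (K <= k)%N & x = F (repr a k) 0 i]).
    by split; exists K => // k /= Kk; exists k.
  move=> [x y] /= [[k Kk ->] [k' Kk' ->]]; rewrite /ball /=.
  apply: le_lt_trans (coord_le_mdist _ _ _) _; apply: le_lt_trans (Fub _ _) _.
  by rewrite mulrC -ltr_pdivlMr //; exact: hK.
have dc (a b : completion X) :
    mdist (F (repr a k)) (F (repr b k)) @[k --> \oo] --> mdist (f a) (f b).
  rewrite [mdist (f a) _]euclideanE; apply: (continuous_cvg _ (@sqrt_continuous R _)).
  apply: cvg_big => [|i _]; first exact: add_continuous.
  by apply: (cvgM (cvgB (fc a i) (fc b i)) (cvgB (fc a i) (fc b i))).
exists f => a b; have ab := seq_dist_cvg (u := repr a) (v := repr b).
rewrite mul1r; apply/andP; split.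
- by apply: (ler_cvg_to ab (dc a b)); apply: nearW => k; exact: Flb.
- have Cab : C * mdist (repr a k) (repr b k) @[k --> \oo] --> C * mdist a b.
    by apply: cvgM => //; exact: cvg_cst.
  by apply: (ler_cvg_to (dc a b) Cab); apply: nearW => k; exact: Fub.
Qed.

End CompletionExtension.

(** * Dyadic scales and off-grid approximation *)

Section PathConstruction.
Context (R : realType) (n : nat).
Implicit Types (x y u D : R) (p q : euclidean R 2).

Notation cd := (path_dist (@carpet R n)).

Lemma dyadic_scale D : 0 < D <= 1 ->
  exists M, (2 ^+ M)^-1 <= 2 * D /\ D <= (2 ^+ M)^-1.
Proof.
move=> /andP[D0 D1].
have ex : exists M, (2 ^+ M)^-1 <= 2 * D.
  exists (Num.truncn D^-1).+1; apply: (@le_trans _ _ D); last by lra.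
  rewrite -[leRHS]invrK lef_pV2 ?posrE ?exprn_gt0 ?invr_gt0 //.
  apply: le_trans (ltW (truncnS_gt _)) _.
  by rewrite -natrX ler_nat ltnW // ltn_expl.
exists (ex_minn ex); case: ex_minnP => M hM min; split=> //.
case: M hM min => [|M] hM min; first by rewrite expr0 invr1.
rewrite leNgt; apply/negP => DM; suff /min : (2 ^+ M)^-1 <= 2 * D by rewrite ltnn.
have -> : (2 ^+ M)^-1 = 2 * (2 ^+ M.+1)^-1 :> R by rewrite exprS; field; rewrite expf_neq0.
by rewrite ler_pM2l // (ltW DM).
Qed.

Lemma off_grid_between (j : nat) u :
  j%:R < u * 2 ^+ n.+1 < j.+1%:R -> off_grid n u.
Proof.
move=> /andP[h1 h2] z zE; move: h1 h2; rewrite zE !ltr_nat ltnS.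
by move=> h1 /(leq_trans h1); rewrite ltnn.
Qed.

(** A short horizontal move that stays within one grid cell meets no slit after leaving [p]. *)
Lemma off_grid_dense p (e : R) : carpet n p -> 0 < e ->
  exists x, [/\ off_grid n x, 0 <= x <= 1 & cd p (pt x (p 0 1)) <= e].
Proof.
move=> cp e0; have [[x01 y01] _] := (carpetP n p).1 cp.
have cpt : carpet n (pt (p 0 0) (p 0 1)) by rewrite -pt_eta.
suff : exists x, [/\ off_grid n x, 0 <= x <= 1 &
    cd (pt (p 0 0) (p 0 1)) (pt x (p 0 1)) <= e] by rewrite -pt_eta.
move: x01 y01 cpt; move: (p 0 0) (p 0 1) => x y x01 y01 cpt {p cp}.
pose W : R := 2 ^+ n.+1; have W0 : 0 < W by rewrite exprn_gt0.
(* On the right edge of the square the move goes left, elsewhere right. *)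
have [x1|x1] := eqVneq x 1.
  pose d := Num.min e (2 * W)^-1.
  have W1 : 1 <= W by rewrite /W exprn_ege1 // ler1n.
  have dW : d * W <= 2^-1.
    rewrite -ler_pdivlMr // -invfM ge_min lexx orbT //.
  have d0 : 0 < d by rewrite lt_min e0 invr_gt0 mulr_gt0.
  have de : d <= e by rewrite ge_min lexx.
  have d1 : d <= 2^-1 by nra.
  have og u : 1 - d <= u < 1 -> off_grid n u.
    move=> /andP[u1 u2]; apply: (@off_grid_between (2 ^ n.+1).-1).
    rewrite prednK ?expn_gt0 // natrX -/W.
    have -> : (2 ^ n.+1).-1%:R = W - 1 :> R.
      by rewrite -subn1 natrB ?expn_gt0 // natrX.
    by apply/andP; split; nra.
  exists (1 - d); split; [by apply: og; apply/andP; split; lra| by apply/andP; split; lra|].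
  rewrite path_dist_sym; apply: le_trans de; have {2}-> : d = x - (1 - d) by rewrite x1; ring.
  apply: path_dist_horizontal => [|u /andP[u1 u2]]; first by lra.
  have [->//|ux] := eqVneq u x.
  apply: off_grid_carpet => //; last by apply/andP; split; lra.
  by apply: og; rewrite u1 lt_neqAle -x1 ux.
have {}x1 : x < 1 by rewrite lt_neqAle x1; case/andP: x01.
have x0 : 0 <= x by case/andP: x01.
pose j := Num.truncn (x * W).
have /andP[jl ju] : j%:R <= x * W < j.+1%:R.
  by apply: truncn_itv; rewrite mulr_ge0 // ltW.
have jW : j.+1%:R <= W.
  have : j%:R < (2 ^ n.+1)%:R :> R by apply: le_lt_trans jl _; rewrite natrX -/W; nra.
  by rewrite ltr_nat => jn; rewrite /W -natrX ler_nat.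
pose g := j.+1%:R / W - x.
have gW : g * W = j.+1%:R - x * W by rewrite mulrBl divfK // gt_eqF.
have g0 : 0 < g by rewrite subr_gt0 ltr_pdivlMr.
pose d := Num.min e (g / 2).
have d0 : 0 < d by rewrite lt_min e0 divr_gt0.
have de : d <= e by rewrite ge_min lexx.
have dg : d < g by apply: (@le_lt_trans _ _ (g / 2)); [rewrite ge_min lexx orbT|lra].
have og u : x < u <= x + d -> off_grid n u.
  move=> /andP[u1 u2]; apply: (@off_grid_between j); rewrite -/W.
  by apply/andP; split; nra.
have xd : x + d <= 1 by nra.
exists (x + d); split; [by apply: og; apply/andP; split; lra| by apply/andP; split; lra|].
apply: le_trans de; have {2}-> : d = x + d - x by ring.
apply: path_dist_horizontal => [|u /andP[u1 u2]]; first by lra.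
have [->//|ux] := eqVneq u x.
apply: off_grid_carpet => //; last by apply/andP; split; lra.
by apply: og; rewrite u2 lt_neqAle eq_sym ux u1.
Qed.

End PathConstruction.

(** * Finding a free row near a given height *)

Section Detour.
Context (R : realType) (n : nat).
Implicit Types (x y u : R) (p q : euclidean R 2).

Notation cd := (path_dist (@carpet R n)).

(** The allowance for a detour: zero when nothing beyond the current scale is needed, otherwise the
    difference of a single bump, which one coordinate of the embedding detects. *)
Definition slit_jump p q (W : R) : Prop :=
  W = 0 \/ exists m l k, [/\ (0 < m <= n)%N, (l < 2 ^ m)%N, (k < 2 ^ m)%N &
    W = `|slit_bump m l k p - slit_bump m l k q|].

(* The slits of level below [M] have their abscissas in 2^-M Z. *)
Lemma row_obstruction x x' M m l m' l' :
  x' - x <= (2 ^+ M)^-1 -> (m < M)%N -> (m' < M)%N ->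
  x < slit_x R m l < x' -> x < slit_x R m' l' < x' -> m = m' /\ l = l'.
Proof.
move=> xx' mM m'M /andP[a1 a2] /andP[b1 b2].
have multiple i c : (i < M)%N -> exists z : nat, slit_x R i c = z%:R / 2 ^+ M.
  move=> iM; exists ((2 * c + 1) * 2 ^ (M - i.+1))%N.
  by apply/eqP; rewrite dyadic_eq -mulnA -expnD subnK.
have [z zE] := multiple _ l mM; have [z' z'E] := multiple _ l' m'M.
suff zz : z = z' by apply: (@slit_abscissa_inj R); rewrite -!/(slit_x R _ _) zE z'E zz.
have D0 : 0 < 2 ^+ M :> R by rewrite exprn_gt0.
move: a1 a2 b1 b2 xx'; rewrite zE z'E; move: (_^-1) (invr_gt0 (2 ^+ M : R)) => T.
rewrite D0 => T0 a1 a2 b1 b2 xx'.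
have le_of_lt (i i' : nat) : i%:R * T < i'%:R * T + T -> (i <= i')%N.
  by move=> h; rewrite -ltnS -(ltr_nat R) -natr1 -(ltr_pM2r T0) mulrDl mul1r.
by apply/eqP; rewrite eqn_leq; apply/andP; split; apply: le_of_lt; lra.
Qed.

Lemma slit_bump_jump m l k p q :
  p 0 0 < slit_x R m l -> slit_x R m l < q 0 0 ->
  hat m l k p <= `|slit_bump m l k p - slit_bump m l k q|.
Proof.
move=> h1 h2; rewrite /slit_bump h1 ltNge (ltW h2) /= -opprD normrN.
by rewrite ger0_norm ?addr_ge0 ?hat_ge0 // lerDl hat_ge0.
Qed.

(* Without an obstruction the row just below [y] is free; otherwise one passes
   the nearer end of the obstructing slit, and the bump of the slit measures the
   distance to that end. *)
Lemma free_row x x' y y' M : off_grid n x -> off_grid n x' ->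
  0 <= x -> x <= x' -> x' <= 1 -> 0 <= y <= 1 -> x' - x <= (2 ^+ M)^-1 ->
  exists b W, [/\ slit_jump (pt x y) (pt x' y') W,
    forall u, x <= u <= x' -> carpet n (pt u (b%:R / 2 ^+ M)), (b <= 2 ^ M)%N &
    `|y - b%:R / 2 ^+ M| <= W + 5 * (2 ^+ M)^-1].
Proof.
move=> ox ox' x0 xx' x1 /andP[y0 y1] hM.
have D0 : 0 < 2 ^+ M :> R by rewrite exprn_gt0.
pose T : R := (2 ^+ M)^-1; have T0 : 0 < T by rewrite invr_gt0.
pose b := Num.truncn (y * 2 ^+ M).
have /andP[bl bu] : b%:R <= y * 2 ^+ M < b.+1%:R.
  by apply: truncn_itv; rewrite mulr_ge0 // ltW.
have bM : (b <= 2 ^ M)%N.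
  by rewrite -(ler_nat R) natrX; apply: le_trans bl _; rewrite ler_piMl // ltW.
have {}bl : b%:R * T <= y by rewrite ler_pdivrMr.
have {}bu : y < b%:R * T + T by rewrite -[X in _ + X]mul1r -mulrDl natr1 ltr_pdivlMr.
(* The ends [x] and [x'] are off the grid, so no slit lies above them. *)
have strict m l k u (h : R) : (m <= n)%N -> x <= u <= x' -> slit m l k (pt u h) ->
    x < slit_x R m l < x'.
  move=> mn /andP[u1 u2] s; have [+ _] := s; rewrite pt0 -/(slit_x R m l) => uE.
  rewrite -uE !lt_neqAle u1 u2 !andbT; apply/andP; split; apply/eqP => e.
  - by apply: (slit_on_grid mn ox (y := h)); rewrite e; exact: s.
  - by apply: (slit_on_grid mn ox' (y := h)); rewrite -e; exact: s.
have row01 u : x <= u <= x' -> 0 <= u <= 1.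
  by move=> /andP[u1 u2]; apply/andP; split; [exact: le_trans u1|exact: le_trans x1].
have [free|] := pselect (forall u, x <= u <= x' -> carpet n (pt u (b%:R / 2 ^+ M))).
  exists b, 0; split=> //; first by left.
  by rewrite -/T ger0_norm; lra.
move=> /existsNP[u /not_implyP[uxx' nc]].
have [m [l [k [mn lm km mM s]]]] : exists m l k, [/\ (0 < m <= n)%N, (l < 2 ^ m)%N,
    (k < 2 ^ m)%N, (m < M)%N & slit m l k (pt u (b%:R / 2 ^+ M))].
  apply: contrapT => h; apply: nc; apply: carpet_row => // [|m l k *]; first exact: row01.
  by move=> ?; apply: h; exists m, l, k.
have [_ mn'] := andP mn; have lx := strict _ _ _ _ _ mn' uxx' s.
(* A row misses every slit as soon as it misses those in the column of [m, l]. *)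
have reroute c : (c <= 2 ^ M)%N ->
    (forall k', ((4 * k' + 1) * 2 ^ M <= c * 2 ^ m.+2 <= (4 * k' + 3) * 2 ^ M)%N -> False) ->
    forall u', x <= u' <= x' -> carpet n (pt u' (c%:R / 2 ^+ M)).
  move=> cM hc u' u'xx'; apply: carpet_row => // [|m' l' k' m'n _ _ m'M s'].
    exact: row01.
  have [_ m'n'] := andP m'n.
  have [mm' _] := row_obstruction hM mM m'M lx (strict _ _ _ _ _ m'n' u'xx' s').
  case: s' => _; rewrite pt1 !dyadic_le -mm'; exact: hc.
have {}s : ((4 * k + 1) * 2 ^ M <= b * 2 ^ m.+2 <= (4 * k + 3) * 2 ^ M)%N.
  by case: s => _; rewrite pt1 !dyadic_le.
(* A slit of level [M - 1] meets only the row [2 * k + 1], so moving one row down suffices and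
   [W = 0]. *)
have [mM1|mM1] := eqVneq m.+1 M.
  have sc i c : (i * 2 ^ M <= c * 2 ^ m.+2)%N = (i <= c * 2)%N.
    by rewrite expnS mM1 mulnA leq_pmul2r // expn_gt0.
  have sc' i c : (c * 2 ^ m.+2 <= i * 2 ^ M)%N = (c * 2 <= i)%N.
    by rewrite expnS mM1 mulnA leq_pmul2r // expn_gt0.
  have bE : b = (2 * k + 1)%N.
    by move: s; rewrite sc sc' => /andP[s1 s2]; clear -s1 s2; lia.
  exists (2 * k)%N, 0; split; first by left.
  - apply: reroute; first by rewrite -mM1 expnS leq_pmul2l // ltnW.
    by move=> k'; rewrite sc sc' => /andP[h1 h2]; clear -h1 h2; lia.
  - by rewrite -mM1 expnS leq_pmul2l // ltnW.
  - move: bl bu; rewrite bE natrD mulrDl mul1r -/T => bl bu.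
    by rewrite ger0_norm; lra.
have {}mM1 : (m.+2 <= M)%N by rewrite ltn_neqAle mM1.
(* Half the slit is [a] rows long: its ends are the rows [(4 * k + 1) * a] and [(4 * k + 3) * a],
   its centre is [(4 * k + 2) * a]. *)
pose a := (2 ^ (M - m.+2))%N; have a0 : (0 < a)%N by rewrite expn_gt0.
have E : (2 ^ M = a * 2 ^ m.+2)%N by rewrite -expnD subnK.
have aT : (2 ^+ m.+2)^-1 = a%:R * T :> R.
  have aR : a%:R != 0 :> R by rewrite pnatr_eq0 -lt0n.
  have P : 2 ^+ M = a%:R * 2 ^+ m.+2 :> R by rewrite -natrX E natrM natrX.
  by rewrite /T P; move: (a%:R) aR => v aR; field; rewrite aR expf_neq0.
have scale i c : ((i * 2 ^ M <= c * 2 ^ m.+2) = (i * a <= c))%N.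
  by rewrite E mulnA leq_pmul2r // expn_gt0.
have scale' i c : ((c * 2 ^ m.+2 <= i * 2 ^ M) = (c <= i * a))%N.
  by rewrite E mulnA leq_pmul2r // expn_gt0.
move: s; rewrite scale scale' => /andP[s1 s2].
have sy : slit_y R m k = (4 * k + 2)%:R * (a%:R * T).
  by rewrite -aT slit_yE.
have [lx1 lx2] := andP lx.
have Wge (h : R) : `|y - slit_y R m k| <= h -> a%:R * T - h - T <=
    `|slit_bump m l k (pt x y) - slit_bump m l k (pt x' y')|.
  move=> hh; apply: le_trans (slit_bump_jump k _ _); rewrite ?pt0 //.
  rewrite /hat pt0 pt1 le_max; apply/orP; right; rewrite aT.
  have hx : `|x - slit_x R m l| <= T.
    by rewrite ler_norml; move: hM; rewrite -/T => hM; apply/andP; split; lra.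
  by lra.
have jump : slit_jump (pt x y) (pt x' y')
    `|slit_bump m l k (pt x y) - slit_bump m l k (pt x' y')|.
  by right; exists m, l, k.
have kM : ((4 * k + 4) * a <= 2 ^ M)%N.
  by rewrite E mulnC leq_pmul2l // 2!expnS; clear -km; lia.
have aR : 0 < a%:R * T by rewrite mulr_gt0 // ltr0n.
have [bk|bk] := leqP b ((4 * k + 2) * a).
(* The row just below the lower end; the slits below it in the column end at [(4 * k - 1) * a] or
   lower. *)
- exists ((4 * k + 1) * a).-1; eexists; split; first exact: jump.
  + apply: reroute; first by clear -kM a0; lia.
    move=> k'; rewrite scale scale' => /andP[h1 h2].
    have h3 : (4 * k' + 1 < 4 * k + 1)%N.
      by rewrite -(ltn_pmul2r a0) (leq_ltn_trans h1) // ltn_predL muln_gt0 a0 addn1.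
    have h4 : ((4 * k' + 4) * a <= 4 * k * a)%N.
      by rewrite leq_pmul2r //; clear -h3; lia.
    by clear -h2 h4 a0; lia.
  + by clear -kM a0; lia.
  + have hb : (((4 * k + 1) * a).-1)%:R = (4 * k + 1)%:R * a%:R - 1 :> R.
      by rewrite -subn1 natrB ?natrM // muln_gt0 a0 addn1.
    have := Wge ((4 * k + 2)%:R * (a%:R * T) - b%:R * T + T).
    have : b%:R * T <= (4 * k + 2)%:R * (a%:R * T).
      by rewrite mulrA ler_pM2r // -natrM ler_nat.
    have : (4 * k + 1)%:R * (a%:R * T) <= b%:R * T.
      by rewrite mulrA ler_pM2r // -natrM ler_nat.
    rewrite hb -/T mulrBl mul1r -mulrA sy !ler_norml !natrD !mulrDl.
    move: (`|slit_bump _ _ _ _ - _|) => W h1 h2 h3.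
    have {h3} := h3 (ltac:(apply/andP; split; lra)).
    by move=> h3; apply/andP; split; lra.
(* Symmetrically, the row just above the upper end. *)
- exists ((4 * k + 3) * a).+1; eexists; split; first exact: jump.
  + apply: reroute; first by clear -kM a0; lia.
    move=> k'; rewrite scale scale' => /andP[h1 h2].
    have h3 : (4 * k + 3 < 4 * k' + 3)%N.
      by rewrite -(ltn_pmul2r a0) (leq_trans _ h2).
    have h4 : ((4 * k + 4) * a <= 4 * k' * a)%N.
      by rewrite leq_pmul2r //; clear -h3; lia.
    by clear -h1 h4 a0; lia.
  + by clear -kM a0; lia.
  + have := Wge (b%:R * T + T - (4 * k + 2)%:R * (a%:R * T)).
    have : (4 * k + 2)%:R * (a%:R * T) <= b%:R * T.
      by rewrite mulrA ler_pM2r // -natrM ler_nat ltnW.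
    have : b%:R * T <= (4 * k + 3)%:R * (a%:R * T).
      by rewrite mulrA ler_pM2r // -natrM ler_nat.
    rewrite -natr1 natrM -/T [(_ + 1) * T]mulrDl mul1r -mulrA sy !ler_norml !natrD !mulrDl.
    move: (`|slit_bump _ _ _ _ - _|) => W h1 h2 h3.
    have {h3} := h3 (ltac:(apply/andP; split; lra)).
    by move=> h3; apply/andP; split; lra.
Qed.

End Detour.

(** * Upper bound: the embedding by coordinates and bumps *)

Section Embedding.
Context (R : realType) (n : nat).
Implicit Types (x y : R) (p q : euclidean R 2).

Notation cd := (path_dist (@carpet R n)).

(** The path goes vertically to the row of [free_row], along it, and vertically to the target. With
    [D] the larger coordinate difference and [2^-M <= 2 * D], its length is at most [2 * (W + 5 *
    2^-M) + 2 * D <= 2 * W + 22 * D]. *)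
Lemma path_dist_le_jump x y x' y' : off_grid n x -> off_grid n x' ->
  0 <= x <= 1 -> 0 <= x' <= 1 -> 0 <= y <= 1 -> 0 <= y' <= 1 ->
  exists2 W, slit_jump n (pt x y) (pt x' y') W &
    cd (pt x y) (pt x' y') <= 2 * W + 22 * mdist (pt x y) (pt x' y').
Proof.
wlog xx' : x x' y y' / x <= x'.
  move=> W ox ox' x01 x01' y01 y01'; have [xx'|/ltW xx'] := leP x x'; first exact: W.
  have [w [->|[m [l [k [h1 h2 h3 ->]]]]] hw] := W _ _ _ _ xx' ox' ox x01' x01 y01' y01.
    by exists 0; [left|rewrite path_dist_sym metric_sym].
  eexists; first by right; exists m, l, k; split.
  by rewrite path_dist_sym metric_sym distrC.
move=> ox ox' x01 x01' y01 y01'.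
have [xE|xNE] := eqVneq x x'.
  exists 0; first by left.
  rewrite mulr0 add0r -xE; apply: le_trans (path_dist_vertical ox x01 y01 y01') _.
  by rewrite mdist_vertical; have := normr_ge0 (y - y'); lra.
have {xNE}x_lt : x < x' by rewrite lt_neqAle xNE.
pose D := Num.max (x' - x) `|y - y'|.
have [x0 x1] := andP x01; have [x0' x1'] := andP x01'.
have D1 : 0 < D <= 1.
  rewrite lt_max subr_gt0 x_lt ge_max ler_norml /=.
  by move: y01 y01' => /andP[? ?] /andP[? ?]; apply/andP; split; [|apply/andP; split]; lra.
have [M [M1 M2]] := dyadic_scale D1.
have xD : x' - x <= D by rewrite le_max lexx.
have yD : `|y - y'| <= D by rewrite le_max lexx orbT.
have [b [W [jW free bM hb]]] :=
  free_row y' ox ox' x0 xx' x1' y01 (le_trans xD M2).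
exists W => //; set h := b%:R / 2 ^+ M in free hb *.
have h01 : 0 <= h <= 1.
  rewrite /h divr_ge0 ?exprn_ge0 //= ler_pdivrMr ?exprn_gt0 // mul1r.
  by rewrite -natrX ler_nat.
have mD : D <= mdist (pt x y) (pt x' y').
  rewrite ge_max; have := coord_le_mdist (pt x y) (pt x' y') 0; rewrite !pt0.
  have := coord_le_mdist (pt x y) (pt x' y') 1; rewrite !pt1 => -> .
  by rewrite distrC ger0_norm ?subr_ge0 // => ->.
have c1 := off_grid_carpet ox x01 y01; have c2 := off_grid_carpet ox x01 h01.
have c3 := off_grid_carpet ox' x01' h01; have c4 := off_grid_carpet ox' x01' y01'.
have := path_dist_triangle c1 c2 c4; have := path_dist_triangle c2 c3 c4.
have := path_dist_vertical ox x01 y01 h01; have := path_dist_vertical ox' x01' h01 y01'.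
have := path_dist_horizontal xx' free; have := ler_distD y h y'.
rewrite [`|h - y|]distrC; lra.
Qed.

Let level_slit : finType := ('I_n * ('I_(2 ^ n) * 'I_(2 ^ n)))%type.

(** The ordinal [m] stands for level [m.+1]. All levels share the index range [2^n], padded with
    zero coordinates. *)
Let bump_coord p (s : level_slit) : R :=
  let: (m, (l, k)) := s in
  if (l < 2 ^ m.+1)%N && (k < 2 ^ m.+1)%N then slit_bump m.+1 l k p else 0.

Let coord_index : finType := (level_slit + 'I_2)%type.

Definition bump_embedding p : euclidean R #|{: coord_index}| :=
  \row_i match enum_val i with inl s => bump_coord p s | inr j => p 0 j end.

Let sqr_bump_embedding p q :
  mdist (bump_embedding p) (bump_embedding q) ^+ 2 =
  \sum_s (bump_coord p s - bump_coord q s) ^+ 2 + mdist p q ^+ 2.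
Proof.
rewrite !sqr_mdist.
pose phi (i : coord_index) := (match i with inl s => bump_coord p s | inr j => p 0 j end -
  match i with inl s => bump_coord q s | inr j => q 0 j end) ^+ 2.
transitivity (\sum_(i < #|{: coord_index}|) phi (enum_val i)).
  by apply: eq_bigr => i _; rewrite !mxE.
by rewrite -(big_enum_val phi) big_sumType.
Qed.

(** The supports lie in distinct open dyadic squares of one level, so at most one bump per level is
    nonzero at [p]. *)
Let bump_coord_inj p (m : 'I_n) t t' :
  bump_coord p (m, t) != 0 -> bump_coord p (m, t') != 0 -> t = t'.
Proof.
have sandwich (a b : nat) (u : R) : a%:R < u < a.+1%:R -> b%:R < u < b.+1%:R -> a = b.
  move=> /andP[h1 h2] /andP[h3 h4]; apply/eqP; rewrite eqn_leq; apply/andP.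
  by split; rewrite -ltnS -(ltr_nat R); [exact: lt_trans h1 h4|exact: lt_trans h3 h2].
case: t t' => l k [l' k'] /=; case: ifP => [_|_]; last by rewrite eqxx.
move=> /slit_bump_supp[h1 h2]; case: ifP => [_|_]; last by rewrite eqxx.
move=> /slit_bump_supp[h3 h4]; congr pair; apply: val_inj;
  [exact: sandwich h1 h3|exact: sandwich h2 h4].
Qed.

Let bump_coord_lip p q s : carpet n p -> carpet n q ->
  (bump_coord p s - bump_coord q s) ^+ 2 <= 4 * cd p q ^+ 2.
Proof.
case: s => m [l k] cp cq /=; case: ifP => [/andP[lm km]|_]; last first.
  by rewrite subrr expr0n mulr_ge0 // sqr_ge0.
have -> : 4 * cd p q ^+ 2 = (2 * cd p q) ^+ 2 by ring.
rewrite -real_normK ?num_real // lerXn2r ?nnegrE ?mulr_ge0 ?path_dist_ge0 //.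
by apply: slit_bump_lip; rewrite ?ltn_ord.
Qed.

(** Per level at most two bumps, one at [p] and one at [q], contribute at most [4 * c^2] each. With
    the plane coordinates the square is at most [(8 * n + 1) * c^2 <= 9 * n * c^2]. *)
Lemma bump_embedding_lip p q : (0 < n)%N -> carpet n p -> carpet n q ->
  mdist (bump_embedding p) (bump_embedding q) <= 3 * Num.sqrt n%:R * cd p q.
Proof.
move=> n0 cp cq; have c0 := path_dist_ge0 cp cq.
have n1 : 1 <= n%:R :> R by rewrite ler1n.
rewrite -[leLHS]ger0_norm ?mdist_ge0 // -[leRHS]ger0_norm; last first.
  by rewrite !mulr_ge0 ?sqrtr_ge0.
rewrite -ler_sqr ?nnegrE // !real_normK ?num_real // sqr_bump_embedding.
have -> : (3 * Num.sqrt n%:R * cd p q) ^+ 2 = 9 * n%:R * cd p q ^+ 2.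
  by rewrite !exprMn sqr_sqrtr ?ler0n //; congr (_ * _ * _); ring.
set c := cd p q in c0 *.
have sum1 (m : 'I_n) r : \sum_(t : 'I_(2 ^ n) * 'I_(2 ^ n))
    (bump_coord r (m, t) != 0)%:R <= 1 :> R.
  rewrite -natr_sum -big_mkcond /= sum1_card lern1.
  by apply/card_le1_eqP => t t' h h'; exact: bump_coord_inj h' h.
have level (m : 'I_n) : \sum_t (bump_coord p (m, t) - bump_coord q (m, t)) ^+ 2 <= 8 * c ^+ 2.
  apply: (@le_trans _ _ (\sum_t (4 * c ^+ 2 * (bump_coord p (m, t) != 0)%:R +
      4 * c ^+ 2 * (bump_coord q (m, t) != 0)%:R))).
    apply: ler_sum => t _; have h := bump_coord_lip (m, t) cp cq.
    have c2 : 0 <= 4 * c ^+ 2 by rewrite mulr_ge0 // sqr_ge0.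
    case: eqVneq => [p0|_]; case: eqVneq => [q0|_]; rewrite ?mulr1 ?mulr0 ?addr0 ?add0r //.
    - by rewrite p0 q0 subrr expr0n.
    - by apply: le_trans h _; rewrite lerDl.
  rewrite big_split /= -!mulr_sumr; have := sum1 m p; have := sum1 m q.
  move: (\sum_t _) (\sum_t _) => A B A1 B1; have := sqr_ge0 c; nra.
have : \sum_s (bump_coord p s - bump_coord q s) ^+ 2 <= n%:R * (8 * c ^+ 2).
  have -> : \sum_s (bump_coord p s - bump_coord q s) ^+ 2 =
      \sum_m \sum_t (bump_coord p (m, t) - bump_coord q (m, t)) ^+ 2.
    by rewrite pair_bigA; apply: eq_bigr => -[m t] _.
  apply: (@le_trans _ _ (\sum_(m < n) 8 * c ^+ 2)); first by apply: ler_sum => m _; exact: level.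
  by rewrite sumr_const card_ord -[leLHS]mulr_natl.
have : mdist p q ^+ 2 <= c ^+ 2.
  by rewrite lerXn2r ?nnegrE ?mdist_ge0 //; exact: mdist_le_path_dist.
have : c ^+ 2 <= n%:R * c ^+ 2 by rewrite ler_peMl // sqr_ge0.
lra.
Qed.

Lemma le_mdist_bump_embedding p q W : slit_jump n p q W ->
  W <= mdist (bump_embedding p) (bump_embedding q) /\
  mdist p q <= mdist (bump_embedding p) (bump_embedding q).
Proof.
move=> jW; split; last first.
  rewrite -ler_sqr ?nnegrE ?mdist_ge0 // sqr_bump_embedding lerDr.
  by apply: sumr_ge0 => s _; exact: sqr_ge0.
case: jW => [->|[m [l [k [/andP[m0 mn] lm km ->]]]]]; first exact: mdist_ge0.
have m1 : (m.-1 < n)%N by rewrite prednK.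
have ln : (l < 2 ^ n)%N by apply: leq_trans lm _; rewrite leq_exp2l.
have kn : (k < 2 ^ n)%N by apply: leq_trans km _; rewrite leq_exp2l.
pose i : coord_index := inl (Ordinal m1, (Ordinal ln, Ordinal kn)).
have := coord_le_mdist (bump_embedding p) (bump_embedding q) (enum_rank i).
by rewrite !mxE enum_rankK /= prednK // lm km.
Qed.

(** For off-grid points [24 = 2 + 22] comes from [path_dist_le_jump], as the image distance bounds
    both [W] and the Euclidean distance. *)
Lemma path_dist_le_bump_embedding p q : (0 < n)%N -> carpet n p -> carpet n q ->
  cd p q <= 24 * mdist (bump_embedding p) (bump_embedding q).
Proof.
move=> n0 cp cq; apply/ler_addgt0Pr => e e0.
pose L : R := 3 * Num.sqrt n%:R; have L0 : 0 <= L by rewrite mulr_ge0 ?sqrtr_ge0.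
(* Replacing [p] and [q] by off-grid points costs [2 * d] in the carpet and [24 * (2 * L * d)] in
   the image. *)
pose d := e / (2 + 48 * L); have d0 : 0 < d by rewrite divr_gt0 //; lra.
have dE : d * (2 + 48 * L) = e by rewrite divfK // gt_eqF //; lra.
have [x [ox x01 dx]] := off_grid_dense cp d0.
have [x' [ox' x01' dx']] := off_grid_dense cq d0.
have [[_ y01] _] := (carpetP n p).1 cp; have [[_ y01'] _] := (carpetP n q).1 cq.
have cp' := off_grid_carpet ox x01 y01; have cq' := off_grid_carpet ox' x01' y01'.
have [W /le_mdist_bump_embedding[hW hm] hd] := path_dist_le_jump ox ox' x01 x01' y01 y01'.
have t1 := path_dist_triangle cp cp' cq.
have t2 := path_dist_triangle cp' cq' cq.
set p' := pt x _ in cp' dx hW hm hd t1 t2; set q' := pt x' _ in cq' dx' hW hm hd t1 t2.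
rewrite (path_dist_sym _ q') in t2.
have t3 := metric_triangle (bump_embedding p') (bump_embedding p) (bump_embedding q').
have t4 := metric_triangle (bump_embedding p) (bump_embedding q) (bump_embedding q').
have l1 : mdist (bump_embedding p') (bump_embedding p) <= L * d.
  rewrite metric_sym; apply: le_trans (bump_embedding_lip n0 cp cp') _; exact: ler_wpM2l.
have l2 : mdist (bump_embedding q) (bump_embedding q') <= L * d.
  by apply: le_trans (bump_embedding_lip n0 cq cq') _; exact: ler_wpM2l.
move: dE t1 t2 t3 t4 l1 l2 dx dx' hW hm hd; lra.
Qed.

End Embedding.

(** * The two bounds for the distortion of the completed carpet *)

Section Distortion.
Context (R : realType) (n : nat).

Lemma mdistZ N (c : R) (u v : euclidean R N) : 0 <= c ->
  mdist (c *: u : euclidean R N) (c *: v) = c * mdist u v.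
Proof.
move=> c0; rewrite !euclideanE -[X in _ = X * _](ger0_norm c0) -sqrtr_sqr -sqrtrM ?sqr_ge0 //.
by rewrite mulr_sumr; congr Num.sqrt; apply: eq_bigr => i _; rewrite !mxE; ring.
Qed.

Lemma distortion_le : (0 < n)%N ->
  (euclidean_distortion (slit_carpet R n) <= (72 * Num.sqrt n%:R)%:E)%E.
Proof.
move=> n0; have n1 : 1 <= Num.sqrt n%:R :> R by rewrite -[leLHS]sqrtr1 ler_wsqrtr // ler1n.
have inC (u : carpet_space R n) : carpet n (val u) by apply/set_mem/valP.
(* Scaling by 24 makes the lower constant 1 and the upper one [24 * 3 * sqrt n]. *)
pose F (u : carpet_space R n) : euclidean R _ := 24 *: bump_embedding n (val u).
apply: ereal_inf_lbound; exists (72 * Num.sqrt n%:R) => //; split; first by lra.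
have [|||f hf] := @bilipschitz_completion R _ _ F (72 * Num.sqrt n%:R).
- by lra.
- move=> u v; rewrite mdistZ //; exact: path_dist_le_bump_embedding.
- move=> u v; rewrite mdistZ //; have := bump_embedding_lip n0 (inC u) (inC v).
  by rewrite -[path_dist _ _ _]/(mdist u v); lra.
by exists _, f.
Qed.

Lemma le_distortion : (3 <= n)%N ->
  ((24^-1 * Num.sqrt (n%:R / ln n%:R))%:E <= euclidean_distortion (slit_carpet R n))%E.
Proof.
move=> n3; apply: le_ereal_inf_tmp => _ [C [C1 [N [f hf]]] <-]; rewrite lee_fin.
have C0 : 0 <= C by lra.
(* The restriction of [f] to the carpet, extended by the default value 0 to the plane; the bounds
   concern carpet points only. *)
pose G p : euclidean R N :=
  if pselect (carpet n p) is left cp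
  then f (completion_in (SigSub (mem_set cp) : carpet_space R n)) else 0.
have GE p q : carpet n p -> carpet n q ->
    1 * path_dist (carpet n) p q <= mdist (G p) (G q) <= C * path_dist (carpet n) p q.
  move=> cp cq; rewrite /G; case: pselect => // cp'; case: pselect => // cq'.
  by have := hf (completion_in (SigSub (mem_set cp') : carpet_space R n))
      (completion_in (SigSub (mem_set cq') : carpet_space R n));
    rewrite completion_in_isometry.
have h : n%:R / ln n%:R <= 576 * C ^+ 2 :> R.
  apply: (@distortion_ge R n N G C) => // p q cp cq; have /andP[] := GE _ _ cp cq => //.
  by rewrite mul1r.
rewrite ler_pdivrMl // -[leRHS]ger0_norm ?mulr_ge0 // -sqrtr_sqr ler_wsqrtr //.
by rewrite exprMn; apply: le_trans h _; rewrite ler_wpM2r ?sqr_ge0 // -natrX ler_nat.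
Qed.

End Distortion.

Theorem theorem1p1 (R : realType) :
  exists (c C : R) (n0 : nat), [/\ 0 < c, 0 < C, (2 <= n0)%N &
    forall n : nat, (n0 <= n)%N ->
      ((c * Num.sqrt (n%:R / ln n%:R))%:E <=
         euclidean_distortion (slit_carpet R n) <=
       (C * Num.sqrt n%:R)%:E)%E].
Proof.
exists 24^-1, 72, 3%N; split=> // n n3.
by rewrite le_distortion // distortion_le // (leq_trans _ n3).
Qed.
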